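(* Let $k$ be a field. For $1\le i\le t$ let $M_i=U(n_i-1,n_i)$ with $n_i\ge 2$, and assume $E(M_i)\cap E(M_j)=\{p\}$ for all $i\neq j$. Then the parallel connection $M=P(M_1,\ldots,M_t;p)$ has an NBC basis.
   Context: $U(r,n)$ is the uniform matroid on an $n$-element set whose bases are all $r$-element subsets. For matroids $M,N$ with $p\in E(M)\cap E(N)$, $P(M,N;p)$ is the matroid on $E(M)\cup E(N)$ with circuits $\mathcal{C}(M)\cup\mathcal{C}(N)\cup\{(C_1\cup C_2)\setminus\{p\}: C_1\in\mathcal{C}(M), C_2\in\mathcal{C}(N), p\in C_1\cap C_2\}$; iteratively $P(M_1,\ldots,M_t;p)=P_t$ with $P_1=M_1$, $P_i=P(P_{i-1},M_i;p)$. NBC basis: for a regular matroid $N$ of rank $s$ with ground set ordered $e_1<\cdots<e_m$ such that $B=\{e_{m-s+1},\ldots,e_m\}$ is a basis, let $\mathrm{ci}(B,e)$ ($e\notin B$) be the unique circuit in $B\cup\{e\}$ and $\mathrm{coc}(B,b)$ ($b\in B$) the unique cocircuit in $(E\setminus B)\cup\{b\}$ containing $b$. With an admissible signed fundamental cocircuit incidence matrix $(a^*_{ji})$ (a $\pm1$-signing of the $0/1$ incidence matrix of the cocircuits $\mathrm{coc}(B,e_j)$, restricted from a signing of the full cocircuit incidence matrix that is orthogonal over $k$ to some signing of the full circuit incidence matrix), put $\Theta^B=\{\sum_{e_i\in\mathrm{coc}(B,e_j)}a^*_{ji}x_i: e_j\in B\}$ and $k(\Delta_{\mathrm{BC}}(N))=k[x_1,\ldots,x_m]/(\langle\prod_{e_i\in\overline{C}}x_i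 : C\text{ circuit}\rangle+(\Theta^B))$, where $\overline{C}=C\setminus\{\min C\}$. Label circuits with $C_i=\mathrm{ci}(B,e_i)$ for $i\le m-s$; let $d_j=j$ for $j\le m-s$, $d_j=\min\{i: e_i\in\mathrm{coc}(B,e_j)\}$ for $j>m-s$; $m_{C_i}=x_i^{|\overline{C}_i|}$ for $i\le m-s$ and $m_{C_i}=\prod_{e_j\in\overline{C}_i}x_{d_j}$ otherwise; $L(N)$ = monomials in $x_1,\ldots,x_{m-s}$ divisible by no $m_C$. $N$ has an NBC basis if for some such ordering the images of $L(N)$ form a $k$-basis of $k(\Delta_{\mathrm{BC}}(N))$. *)

(* Defs.v *)
From HB Require Import structures.
From mathcomp Require Import all_boot all_order all_algebra.
From mathcomp Require Import mpoly.
Set Implicit Arguments. Unset Strict Implicit. Unset Printing Implicit Defensive.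
Import Order.TTheory GRing.Theory.

Record matroid (T : finType) := Matroid {
  ground : {set T};
  circuits : {set {set T}} }.

Section MatroidDefs.
Context {T : finType}.
Implicit Types (N : matroid T) (X Y C D B : {set T}).

(* U(r, E): the uniform matroid of rank r on E (bases = r-subsets of E);
   its circuits are the (r+1)-subsets of E. *)
Definition uniform_matroid (r : nat) (E : {set T}) : matroid T :=
  Matroid E [set C in powerset E | #|C| == r.+1].

Definition par_conn (M N : matroid T) (p : T) : matroid T :=
  Matroid (ground M :|: ground N)
    (circuits M :|: circuits N :|:
     [set (C1 :|: C2) :\ p | C1 in circuits M, C2 in circuits N
                           & (p \in C1) && (p \in C2)]).

Definition par_conn_seq (p : T) (Ms : seq (matroid T)) : matroid T :=
  match Ms with
  | [::] => Matroid set0 set0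
  | M1 :: Ms' => foldl (fun P Mi => par_conn P Mi p) M1 Ms'
  end.

Definition indep N X : bool :=
  (X \subset ground N) && [forall C in circuits N, ~~ (C \subset X)].

Definition is_basis N B : bool :=
  indep N B && [forall Y : {set T}, (indep N Y && (B \subset Y)) ==> (Y == B)].

Definition is_cocircuit N D : bool :=
  minset (fun D' : {set T} => (D' \subset ground N) &&
           [forall B : {set T}, is_basis N B ==> ~~ [disjoint D' & B]]) D.

(* ci(B, e): the (unique) circuit contained in B ∪ {e} *)
Definition fund_circuit N B (x : T) : {set T} :=
  odflt set0 [pick C in circuits N | C \subset x |: B].

(* coc(B, b): the (unique) cocircuit in (E \ B) ∪ {b} containing b *)
Definition fund_cocircuit N B (b : T) : {set T} :=
  odflt set0 [pick D | [&& is_cocircuit N D,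
                           D \subset (ground N :\: B) :|: [set b] & b \in D]].

Definition representable_over (F : fieldType) N : Prop :=
  exists (n : nat) (v : T -> 'rV[F]_n),
    forall X, X \subset ground N ->
      (indep N X <-> row_free (\matrix_(i < #|X|) v (enum_val i))).

Definition regular N : Prop := forall F : fieldType, representable_over F N.

(* Admissible signings: aC signs the full circuit incidence matrix, aD the full
   cocircuit incidence matrix, and they are orthogonal over k. *)
Definition admissible_signing (k : fieldType) N (aC aD : {set T} -> T -> int) : Prop :=
  [/\ forall C x, C \in circuits N ->
        (x \in C -> aC C x = 1%R \/ aC C x = (-1)%R) /\ (x \notin C -> aC C x = 0%R),
      forall D x, is_cocircuit N D ->
        (x \in D -> aD D x = 1%R \/ aD D x = (-1)%R) /\ (x \notin D -> aD D x = 0%R)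
    & forall C D, C \in circuits N -> is_cocircuit N D ->
        (\sum_(x in ground N) ((aC C x)%:~R * (aD D x)%:~R) = 0 :> k)%R].

(* The data attached to an ordering e_0 < ... < e_{m-1} (0-indexed: e i = e_{i+1})
   with B = {e_{m-s}, ..., e_{m-1}} (the last s elements). *)
Section Ordering.
Context (N : matroid T) (m : nat) (e : 'I_m -> T) (s : nat).

Definition last_basis : {set T} := [set e i | i : 'I_m & m - s <= i].

(* indices of C \ {min C} *)
Definition cbar (C : {set T}) : {set 'I_m} :=
  [set i : 'I_m | (e i \in C) && [exists j : 'I_m, (e j \in C) && (j < i)]].

Definition coc_idx (j : 'I_m) : {set 'I_m} :=
  [set i : 'I_m | e i \in fund_cocircuit N last_basis (e j)].

Definition dd (j : 'I_m) : 'I_m :=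
  if (j < m - s)%N then j else [arg min_(i < j in coc_idx j) (i : nat)].

Definition mC (C : {set T}) : 'X_{1..m} :=
  if [pick i : 'I_m | (i < m - s)%N && (fund_circuit N last_basis (e i) == C)]
     is Some i
  then [multinom (if j == i then #|cbar C| else 0%N) | j < m]
  else [multinom #|[set l in cbar C | dd l == j]| | j < m].

Definition inL (mm : 'X_{1..m}) : bool :=
  [forall j : 'I_m, (m - s <= j)%N ==> (mm j == 0%N)] &&
  [forall C in circuits N, ~~ lem (mC C) mm].

Section Ring.
Context (k : fieldType) (aD : {set T} -> T -> int).

Definition circ_monomial (C : {set T}) : {mpoly k[m]} :=
  'X_[ [multinom (i \in cbar C : nat) | i < m] ].

Definition theta (j : 'I_m) : {mpoly k[m]} :=
  \sum_(i : 'I_m | e i \in fund_cocircuit N last_basis (e j))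
     ((aD (fund_cocircuit N last_basis (e j)) (e i))%:~R *: 'X_i)%R.

Definition ideal_gens : seq {mpoly k[m]} :=
  [seq circ_monomial C | C <- enum (circuits N)] ++
  [seq theta j | j <- [seq j <- enum 'I_m | (m - s <= nat_of_ord j)%N]].

Definition in_ideal (G : seq {mpoly k[m]}) (f : {mpoly k[m]}) : Prop :=
  exists c : seq {mpoly k[m]}, f = (\sum_(i < size G) c`_i * G`_i)%R.

(* the images of L(N) form a k-basis of k[x]/I *)
Definition L_is_basis : Prop :=
  (forall f : {mpoly k[m]}, exists g : {mpoly k[m]},
      (forall mm, mm \in msupp g -> inL mm) /\ in_ideal ideal_gens (f - g)%R) /\
  (forall g : {mpoly k[m]},
      (forall mm, mm \in msupp g -> inL mm) -> in_ideal ideal_gens g -> g = 0%R).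
End Ring.
End Ordering.

Definition has_NBC_basis (k : fieldType) N : Prop :=
  regular N /\
  exists (m : nat) (e : 'I_m -> T) (s : nat),
    [/\ injective e, e @: setT = ground N,
        is_basis N (last_basis e s) &
        exists aC aD, admissible_signing k N aC aD /\ L_is_basis N e s k aD].

End MatroidDefs.

(* Main.v *)
Require Import Defs.
From HB Require Import structures.
From mathcomp Require Import all_boot all_order all_algebra.
From mathcomp Require Import mpoly.
Set Implicit Arguments. Unset Strict Implicit. Unset Printing Implicit Defensive.
Import Order.TTheory GRing.Theory.

(** The parallel connection is the cycle matroid of a theta graph: its ground set is
    cut into strands, namely {p} (strand 0) and the sets E_i minus p, and its circuits
    are the unions of two distinct strands. Its cocircuits are the two-element subsets
    of a strand and the transversals of the strands.

    Order the ground set with p first, then one element of every strand but the last,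
    then all the rest. Modulo the linear forms, a variable of strand i equals the
    variable y_i of its chosen element, and a variable of the last strand equals
    - (x_p + y_1 + ... + y_n). Since p comes first, the ideal is generated by the powers
    y_i ^ a_i and (x_p + y_1 + ... + y_n) ^ a_last, where the a's are the strand sizes,
    and L is the set of monomials in x_p, y_1, ..., y_n whose exponents lie below
    a_last, a_1, ..., a_n. These span by the binomial expansion of the last generator.
    They are independent because, in coordinates where the last generator is a power of
    a variable u, the ideal is monomial and the change of coordinates is triangular for
    the degree in u. *)

(** * Theta matroids *)

Section Theta.
Context {T J : finType} (G : {set T}) (cl : T -> J).

Definition strand (o : J) : {set T} := [set x in G | cl x == o].

Definition theta_matroid : matroid T :=
  Matroid G [set strand oo.1 :|: strand oo.2 | oo : J * J & oo.1 != oo.2].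

Context (strand_neq0 : forall o, exists x, x \in strand o).

Lemma in_strand x o : (x \in strand o) = (x \in G) && (cl x == o).
Proof. by rewrite inE. Qed.

Lemma strandG x o : x \in strand o -> x \in G.
Proof. by rewrite inE => /andP[]. Qed.

Lemma strand_cl x o : x \in strand o -> cl x = o.
Proof. by rewrite inE => /andP[_ /eqP]. Qed.

(** * Independent sets, bases and cocircuits of a theta matroid *)

Lemma theta_circuitP (C : {set T}) :
  reflect (exists o o', o != o' /\ C = strand o :|: strand o')
          (C \in circuits theta_matroid).
Proof.
apply: (iffP imsetP) => [[[o o'] /= oo' ->]|[o [o' [oo' ->]]]].
  by exists o, o'; move: oo'; rewrite inE.
by exists (o, o') => //; rewrite inE.
Qed.

Lemma theta_indepP (X : {set T}) :
  reflect (X \subset G /\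
           forall o o', strand o \subset X -> strand o' \subset X -> o = o')
          (indep theta_matroid X).
Proof.
apply: (iffP andP) => [[XG /forallP h]|[XG h]]; split => //.
  move=> o o' oX o'X; apply/eqP/negPn/negP => oo'.
  have /implyP := h (strand o :|: strand o').
  rewrite subUset oX o'X => /(_ _)/negP; case=> //.
  by apply/theta_circuitP; exists o, o'.
apply/forallP => C; apply/implyP => /theta_circuitP[o [o' [oo' ->]]].
by apply/negP; rewrite subUset => /andP[a b]; rewrite (h _ _ a b) eqxx in oo'.
Qed.

(** With one element removed from every strand but [o0], only [o0] stays full; putting back any
    removed element fills a second strand. *)
Lemma theta_basis o0 (r : J -> T) : (forall o, r o \in strand o) ->
  is_basis theta_matroid (G :\: [set r o | o : J & o != o0]).
Proof.
move=> hr; set R := [set r o | o : J & _].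
have onlyo o : strand o \subset G :\: R -> o = o0.
  move=> /subsetP/(_ _ (hr o)); rewrite inE => /andP[nR _].
  apply/eqP/negPn/negP => oo0; case/negP: nR.
  by apply/imsetP; exists o => //; rewrite inE.
apply/andP; split.
  apply/theta_indepP; split; first exact: subsetDl.
  by move=> o o' /onlyo-> /onlyo->.
apply/forallP => Y; apply/implyP => /andP[/theta_indepP[YG hY] BY].
rewrite eqEsubset BY andbT; apply/subsetP => x xY.
rewrite inE (subsetP YG) // andbT; apply/imsetP => -[o].
rewrite inE => oo0 xo; case/eqP: (oo0); apply: hY.
  apply/subsetP => y yo; case: (eqVneq y x) => [->//|yx].
  apply: (subsetP BY); rewrite inE (strandG yo) andbT.
  apply/imsetP => -[o' _ yo'].
  have ? : o' = o by rewrite -(strand_cl (hr o')) -yo' (strand_cl yo).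
  by subst o'; rewrite yo' xo eqxx in yx.
apply: subset_trans BY; apply/subsetP => y yo.
rewrite inE (strandG yo) andbT; apply/imsetP => -[o'].
rewrite inE => /eqP o'o0 yo'; apply: o'o0.
by rewrite -(strand_cl (hr o')) -yo' (strand_cl yo).
Qed.

(** The predicate minimised in [is_cocircuit], to which it unfolds. *)
Definition meets_bases (D : {set T}) :=
  (D \subset G) && [forall B : {set T}, is_basis theta_matroid B ==> ~~ [disjoint D & B]].

(** A basis avoiding [x] and [y] could be enlarged by [x]: the strand of [x] still lacks [y], so no
    strand becomes full. *)
Lemma pair_meets_bases x y : x \in G -> y \in G -> x != y -> cl x = cl y ->
  meets_bases [set x; y].
Proof.
move=> xG yG xy cxy; apply/andP; split.
  by apply/subsetP => z; rewrite !inE => /orP[]/eqP->.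
apply/forallP => B; apply/implyP => /andP[/theta_indepP[BG hB] /forallP hM].
apply/negP; rewrite disjoint_subset => /subsetP dis.
have xB : x \notin B by have := dis x; rewrite !inE eqxx => /(_ isT).
have yB : y \notin B by have := dis y; rewrite !inE eqxx orbT => /(_ isT).
have sub o : strand o \subset x |: B -> strand o \subset B.
  move=> /subsetP h; apply/subsetP => z zo.
  have := h _ zo; rewrite !inE => /orP[/eqP zx|//].
  have : y \in strand o by rewrite inE yG -cxy -zx (strand_cl zo) eqxx.
  by move/h; rewrite !inE eq_sym (negPf xy) (negPf yB).
suff ind : indep theta_matroid (x |: B).
  have /implyP := hM (x |: B); rewrite subsetUr ind => /(_ isT)/eqP e.
  by rewrite -e !inE eqxx in xB.
apply/theta_indepP; split; last by move=> o o' /sub a /sub b; exact: hB.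
by rewrite subUset sub1set xG.
Qed.

(** A basis avoiding a transversal has no full strand, so adding [r o1] fills at most the strand
    [o1] and keeps independence. *)
Lemma transversal_meets_bases (r : J -> T) : J -> (forall o, r o \in strand o) ->
  meets_bases [set r o | o : J].
Proof.
move=> o1 hr; apply/andP; split.
  by apply/subsetP => z /imsetP[o _ ->]; exact: strandG (hr o).
apply/forallP => B; apply/implyP => /andP[/theta_indepP[BG hB] /forallP hM].
apply/negP; rewrite disjoint_subset => /subsetP dis.
have nB o : r o \notin B by have := dis (r o) (imset_f _ isT).
have sub o : strand o \subset r o1 |: B -> o = o1.
  move=> /subsetP/(_ _ (hr o)); rewrite !inE (negPf (nB o)) orbF => /eqP e.
  by rewrite -(strand_cl (hr o)) e (strand_cl (hr o1)).
suff ind : indep theta_matroid (r o1 |: B).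
  have /implyP := hM (r o1 |: B); rewrite subsetUr ind => /(_ isT)/eqP e.
  by have := nB o1; rewrite -e !inE eqxx.
apply/theta_indepP; split; last by move=> o o' /sub -> /sub ->.
by rewrite subUset sub1set (strandG (hr _)).
Qed.

(** If [D] has at most one element in each strand and misses the strand [o0], then removing from [G]
    one element of every other strand, taken in [D] when possible, leaves a basis disjoint from
    [D]. *)
Lemma meets_bases_sub (D : {set T}) : meets_bases D ->
  (exists x y, [/\ x \in D, y \in D, x != y & cl x = cl y]) \/
  (exists r : J -> T, (forall o, r o \in strand o) /\ [set r o | o : J] \subset D).
Proof.
move=> /andP[DG /forallP hD].
have [/existsP[x /existsP[y /and4P[xD yD xy /eqP cxy]]]|npair] :=
  boolP [exists x, exists y, [&& x \in D, y \in D, x != y & cl x == cl y]].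
  by left; exists x, y.
right.
have inj x y : x \in D -> y \in D -> cl x = cl y -> x = y.
  move=> xD yD cxy; apply/eqP/negPn/negP => xy; case/negP: npair.
  by apply/existsP; exists x; apply/existsP; exists y; rewrite xD yD xy cxy /=.
pose r o := odflt (xchoose (strand_neq0 o)) [pick x in D | cl x == o].
have hr o : r o \in strand o.
  rewrite /r; case: pickP => [x /andP[xD /eqP <-]|_] /=.
    by rewrite inE eqxx (subsetP DG).
  exact: xchooseP (strand_neq0 o).
exists r; split=> //; apply/subsetP => _ /imsetP[o0 _ ->].
apply/negPn/negP => nD.
have /implyP/(_ (theta_basis o0 hr)) := hD (G :\: [set r o | o : J & o != o0]).
case/negP; rewrite disjoint_subset; apply/subsetP => x xD.
rewrite !inE (subsetP DG) // andbT negbK; apply/imsetP; exists (cl x).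
  rewrite inE; apply/eqP => cx; case/negP: nD; rewrite /r.
  by case: pickP => [y /andP[]//|/(_ x)]; rewrite xD cx eqxx.
rewrite /r; case: pickP => [y /andP[yD /eqP cy]|/(_ x)] /=.
  by apply: inj.
by rewrite xD eqxx.
Qed.

(** By [meets_bases_sub] it remains to see that no pair or transversal properly contains another
    such set. A second strand keeps a transversal from fitting inside a pair. *)
Lemma theta_cocircuitP (D : {set T}) : 1 < #|J| -> is_cocircuit theta_matroid D <->
  (exists x y, [/\ x \in G, y \in G, x != y, cl x = cl y & D = [set x; y]]) \/
  (exists r : J -> T, (forall o, r o \in strand o) /\ D = [set r o | o : J]).
Proof.
move=> J1; have [o1 [o2 o12]] : exists o1 o2 : J, o1 != o2.
  by have /card_gt1P[o1 [o2 [_ _ h]]] := J1; exists o1, o2.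
split.
  move=> /minsetP[mD hmin]; have /andP[DG _] : meets_bases D := mD.
  case: (meets_bases_sub mD) => [[x [y [xD yD xy cxy]]]|[r [hr rD]]].
    left; exists x, y; split=> //; try exact: (subsetP DG).
    apply/esym; apply: hmin; last by rewrite subUset !sub1set xD yD.
    by apply: pair_meets_bases => //; exact: (subsetP DG).
  right; exists r; split=> //; apply/esym; apply: hmin => //.
  exact: transversal_meets_bases.
case=> [[x [y [xG yG xy cxy ->]]]|[r [hr ->]]]; apply/minsetP; split.
- exact: pair_meets_bases.
- move=> D' mD' /subsetP D'D; apply/eqP; rewrite eqEsubset; apply/andP; split.
    exact/subsetP.
  case: (meets_bases_sub mD') => [[z [w [zD wD zw czw]]]|[r [hr /subsetP rD]]].
    move: (D'D _ zD) (D'D _ wD); rewrite !inE subUset !sub1set.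
    by do 2![case/orP=> /eqP ?]; subst; rewrite ?eqxx // ?zD ?wD in zw *.
  case/eqP: o12; rewrite -(strand_cl (hr o1)) -(strand_cl (hr o2)).
  have := D'D _ (rD _ (imset_f r (isT : o1 \in J))).
  have := D'D _ (rD _ (imset_f r (isT : o2 \in J))).
  by rewrite !inE => /orP[]/eqP-> /orP[]/eqP->.
- exact: transversal_meets_bases.
move=> D' mD' /subsetP D'D; apply/eqP; rewrite eqEsubset; apply/andP; split.
  exact/subsetP.
case: (meets_bases_sub mD') => [[z [w [zD wD zw czw]]]|[r' [hr' /subsetP rD]]].
  case/imsetP: (D'D _ zD) => o _ zo; case/imsetP: (D'D _ wD) => o' _ wo.
  case/eqP: zw; rewrite zo wo; congr r.
  by rewrite -(strand_cl (hr o)) -(strand_cl (hr o')) -zo -wo.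
apply/subsetP => _ /imsetP[o _ ->].
have oD := rD _ (imset_f r' (isT : o \in J)).
case/imsetP: (D'D _ oD) => o' _ e.
have oo' : o = o' by rewrite -(strand_cl (hr o')) -(strand_cl (hr' o)) e.
by rewrite {1}oo' -e.
Qed.

(* Orthogonality: a pair meets a circuit in a full pair with opposite signs, and
   a transversal meets it in one element of each of the two strands. *)
Definition circuit_sign (C : {set T}) (x : T) : int :=
  (if x \in C then
     if [pick y in C] is Some y then if cl x == cl y then 1 else -1 else 0
   else 0)%R.

(** The kind of cocircuit is recovered from the bare set: two elements of a common strand mark a
    pair, and [pick] chooses the positive one. *)
Definition cocircuit_sign (D : {set T}) (x : T) : int :=
  (if x \in D then
     if [exists y in D, exists z in D, (y != z) && (cl y == cl z)] then
       if [pick y in D] == Some x then 1 else -1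
     else 1
   else 0)%R.

Lemma circuit_sign_circuit (C : {set T}) : C \in circuits theta_matroid ->
  exists o o', [/\ o != o', C = strand o :|: strand o' &
    forall x, x \in G -> circuit_sign C x = ((cl x == o)%:R - (cl x == o')%:R)%R].
Proof.
move=> /theta_circuitP[o [o' [oo' eC]]].
wlog eo : o o' oo' eC / exists2 y, [pick y in C] = Some y & cl y = o.
  move=> hw; case e: [pick y in C] => [y|].
    have : y \in C by move: e; case: pickP => // z zC [<-].
    rewrite {1}eC inE => /orP[]/strand_cl cy; first by apply: (hw o o') => //; exists y.
    by apply: (hw o' o); rewrite 1?eq_sym 1?setUC //; exists y.
  move: e; case: pickP => // h _; have [x xo] := strand_neq0 o.
  by have := h x; rewrite eC inE xo.
exists o, o'; split=> // x xG; case: eo => y ey cy.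
rewrite /circuit_sign ey cy eC !inE xG /=.
case: eqVneq => [->|co]; first by rewrite (negPf oo') subr0.
by case: eqVneq => //= _; rewrite ?subr0 ?sub0r.
Qed.

(** The sign [e] records which element [pick] returned; a global sign affects neither orthogonality
    nor the ideal. *)
Lemma cocircuit_sign_pair x y : x != y -> cl x = cl y -> exists e : int,
  [/\ e = 1 \/ e = -1 & forall z, cocircuit_sign [set x; y] z = e * ((z == x)%:R - (z == y)%:R)]%R.
Proof.
move=> xy cxy; rewrite /cocircuit_sign.
have -> : [exists y0 in [set x; y], exists z in [set x; y], (y0 != z) && (cl y0 == cl z)].
  apply/existsP; exists x; rewrite !inE eqxx /=; apply/existsP; exists y.
  by rewrite !inE eqxx orbT xy cxy /=.
have [u] : exists u, [pick y0 in [set x; y]] = Some u /\ ((u = x) \/ (u = y)).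
  case: pickP => [u|/(_ x)]; last by rewrite !inE eqxx.
  by rewrite !inE => /orP[]/eqP->; [exists x|exists y]; split=> //; [left|right].
case=> -> [->|->]; [exists 1%R|exists (-1)%R]; (split; first by [left|right]) => z;
  rewrite !inE (inj_eq Some_inj) [_ == z]eq_sym.
  case: (eqVneq z x) => [->|zx] /=; first by rewrite (negPf xy) subr0 mul1r.
  by case: eqVneq => /= _; rewrite ?subr0 ?mulr0 ?sub0r ?mul1r.
case: (eqVneq z x) => [->|zx] /=; first by rewrite (negPf xy) subr0 mulr1.
by case: eqVneq => /= _; rewrite ?subr0 ?mulr0 ?sub0r ?mulN1r ?opprK.
Qed.

Lemma cocircuit_sign_transversal (r : J -> T) z : (forall o, r o \in strand o) ->
  cocircuit_sign [set r o | o : J] z = (z \in [set r o | o : J])%:R%R.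
Proof.
move=> hr; rewrite /cocircuit_sign; case: ifP => // _; case: existsP => // -[x].
case/andP=> /imsetP[o _ ->] /existsP[y /and3P[/imsetP[o' _ ->]]].
by rewrite !(strand_cl (hr _)) => + /eqP oo'; rewrite oo' eqxx.
Qed.

Lemma theta_admissible (k : fieldType) : 1 < #|J| ->
  admissible_signing k theta_matroid circuit_sign cocircuit_sign.
Proof.
move=> J1; split.
- move=> C x Cc; split=> [xC|/negPf xC]; last by rewrite /circuit_sign xC.
  rewrite /circuit_sign xC; case: pickP => [y _|/(_ x)]; last by rewrite xC.
  by case: ifP; [left|right].
- move=> D x _; split=> [xC|/negPf xC]; last by rewrite /cocircuit_sign xC.
  by rewrite /cocircuit_sign xC; do 2?case: ifP => _; [left|right|left].
move=> C D /circuit_sign_circuit[o [o' [oo' -> hC]]] /(theta_cocircuitP _ J1).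
under eq_bigr => x xG do rewrite hC //.
case=> [[x [y [xG yG xy cxy ->]]]|[r [hr ->]]].
  have [e [_ he]] := cocircuit_sign_pair xy cxy.
  under eq_bigr => z zG do rewrite he.
  rewrite (bigD1 x) //= (bigD1 y) ?yG ?[y == x]eq_sym ?xy //= big1.
    rewrite !eqxx (negPf xy) cxy subr0 sub0r addr0.
    by rewrite mulr1 mulrN1 intrN mulrN subrr.
  by move=> z /andP[/andP[_ /negPf->] /negPf->]; rewrite subrr mulr0 mulr0.
under eq_bigr => z zG do rewrite cocircuit_sign_transversal //.
(* A transversal has one element per strand, so a sum against its indicator becomes a sum over
   strands. *)
have hs (f : T -> k) : (\sum_(z in G) f z * (z \in [set r o | o : J])%:R%:~R = \sum_o f (r o))%R.
  rewrite -(big_imset _ (h := r) (A := predT)) /=; last first.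
    by move=> a b _ _ ab; rewrite -(strand_cl (hr a)) ab (strand_cl (hr b)).
  rewrite [RHS](big_setID G) /= [X in (_ + X)%R]big1 ?addr0.
    rewrite (bigID (mem [set r o | o : J])) /= [X in (_ + X)%R]big1 ?addr0.
      apply: eq_big => [z|z /andP[_ ->]]; last by rewrite mulr1.
      by rewrite inE andbC.
    by move=> z /andP[_ /negPf->]; rewrite mulr0.
  by move=> z; rewrite inE => /andP[+ /imsetP[a _ e]]; rewrite e (strandG (hr a)).
rewrite (hs (fun z => ((cl z == o)%:R - (cl z == o')%:R)%:~R)%R).
under eq_bigr => a _ do rewrite (strand_cl (hr a)) intrB.
rewrite sumrB (bigD1 o) //= [X in (_ - X)%R](bigD1 o') //= !eqxx !big1 ?subrr //.
  by move=> a /negPf->.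
by move=> a /negPf->.
Qed.

(* A relation among the vectors below is a weight that is constant on every strand
   and whose strand values sum to zero. *)
Lemma theta_regular : regular theta_matroid.
Proof.
move=> F; pose r o := xchoose (strand_neq0 o).
have hr o : r o \in strand o := xchooseP (strand_neq0 o).
(* [g x y] is coordinate [y] of the vector of [x]. On a relation [c], column [Some y] equates [c y]
   with the value at the representative of the strand of [y], and column [None] makes the
   representatives sum to zero. *)
pose g (x : T) (y : option T) : F := (if y is Some y then
   if y \in G then (x == y)%:R - (x == r (cl y))%:R else 0
   else (x == r (cl x))%:R)%R.
exists #|{: option T}|, (fun x => \row_i g x (enum_val i))%R => X XG.
set A := (\matrix_i _)%R.
have mulE (u : 'rV[F]_#|X|) (c : T -> F) : (forall i, u 0 i = c (enum_val i))%R ->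
    (forall j, (u *m A) 0 j = \sum_(x in X) c x * g x (enum_val j))%R.
  move=> uc j; rewrite mxE [RHS]big_enum_val /=; apply: eq_bigr => i _.
  by rewrite uc !mxE.
have sumS (c : T -> F) y : (forall x, x \notin X -> c x = 0)%R -> y \in G ->
    (\sum_(x in X) c x * g x (Some y) = c y - c (r (cl y)))%R.
  move=> c0 yG; have sum1 z : (\sum_(x in X) c x * (x == z)%:R = c z)%R.
    case: (boolP (z \in X)) => zX; last first.
      by rewrite big1 ?c0 // => x xX; case: eqVneq => [e|]; rewrite ?mulr0 // -e xX in zX *.
    by rewrite (bigD1 z) //= eqxx mulr1 big1 ?addr0 // => x /andP[_ /negPf->]; rewrite mulr0.
  rewrite /g yG; under eq_bigr => x _ do rewrite mulrBr.
  by rewrite sumrB !sum1.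
have sumN (c : T -> F) : (forall x, x \notin X -> c x = 0)%R ->
    (\sum_(x in X) c x * g x None = \sum_o c (r o))%R.
  move=> c0; rewrite -(big_imset c (h := r) (A := predT)) /=; last first.
    by move=> a b _ _ ab; rewrite -(strand_cl (hr a)) ab (strand_cl (hr b)).
  rewrite (bigID (mem [set r o | o : J])) /= [X in (_ + X)%R]big1 ?addr0; last first.
    move=> z /andP[_ nz]; case: eqVneq => [e|]; rewrite ?mulr0 // e in nz *.
    by case/negP: nz; apply: imset_f.
  rewrite [RHS](big_setID X) /= [X in _ = (_ + X)%R]big1 ?addr0; last first.
    by move=> z; rewrite inE => /andP[/c0].
  apply: eq_big => [z|z /andP[_ /imsetP[a _ ->]]]; first by rewrite inE andbC.
  by rewrite (strand_cl (hr a)) eqxx mulr1.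
split=> [/theta_indepP[_ hX]|Afree].
  apply: inj_row_free => u uA0.
  pose c x := (\sum_(i | enum_val i == x) u 0 i)%R.
  have uc i : (u 0 i = c (enum_val i))%R.
    rewrite /c (big_pred1 i) // => j /=.
    by apply/eqP/eqP => [/enum_val_inj|->].
  have c0 x : x \notin X -> (c x = 0)%R.
    move=> xX; rewrite /c big1 // => i /eqP e.
    by have := enum_valP i; rewrite e (negPf xX).
  have rel y : (\sum_(x in X) c x * g x y = 0)%R.
    have := mulE _ _ uc (enum_rank y); rewrite enum_rankK => <-.
    by rewrite uA0 mxE.
  have cst y : y \in G -> (c y = c (r (cl y)))%R.
    by move=> yG; apply/eqP; rewrite -subr_eq0 -sumS // rel.
  (* A nonzero constant value on a strand forces it into [X], outside which [c] vanishes. *)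
  have full o : (c (r o) != 0)%R -> strand o \subset X.
    move=> co; apply/subsetP => x xo; apply/negPn/negP => /c0.
    by rewrite cst ?(strandG xo) // (strand_cl xo); apply/eqP.
  have cr o : (c (r o) = 0)%R.
    have := rel None; rewrite sumN // (bigD1 o) //=.
    apply: contra_eq => co; rewrite big1 ?addr0 // => o' o'o.
    apply/eqP; apply: contraNT o'o => co'.
    by rewrite (hX _ _ (full _ co') (full _ co)).
  apply/rowP => i; rewrite uc mxE cst ?cr //.
  exact: (subsetP XG) (enum_valP i).
apply/theta_indepP; split=> // o o' oX o'X; apply/eqP/negPn/negP => oo'.
(* Two full strands carry the relation with value 1 on one and -1 on the other. *)
pose c x : F := (if x \in X then (cl x == o)%:R - (cl x == o')%:R else 0)%R.
have c0 x : x \notin X -> (c x = 0)%R by rewrite /c => /negPf->.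
have cE x : x \in G -> (c x = (cl x == o)%:R - (cl x == o')%:R)%R.
  move=> xG; rewrite /c; case: ifPn => // xX.
  case: eqVneq => [e|_].
    by case/negP: xX; apply: (subsetP oX); rewrite inE xG e eqxx.
  case: eqVneq => [e|_]; last by rewrite subrr.
  by case/negP: xX; apply: (subsetP o'X); rewrite inE xG e eqxx.
pose u : 'rV[F]_#|X| := (\row_i c (enum_val i))%R.
have u0 : (u *m A = 0)%R.
  apply/rowP => j; rewrite (mulE _ c) => [|i]; last by rewrite mxE.
  rewrite mxE; case: (enum_val j) => [y|].
    case: (boolP (y \in G)) => yG.
      by rewrite sumS // !cE ?(strandG (hr _)) // (strand_cl (hr _)) subrr.
    by rewrite big1 // => x _; rewrite /g (negPf yG) mulr0.
  rewrite sumN //; under eq_bigr => a _ do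
    rewrite cE ?(strandG (hr _)) // (strand_cl (hr a)).
  rewrite sumrB (bigD1 o) //= [X in (_ - X)%R](bigD1 o') //= !eqxx !big1 ?subrr //.
    by move=> a /negPf->.
  by move=> a /negPf->.
have roX : r o \in X by apply: (subsetP oX).
have : (u = 0)%R by apply: (row_free_inj Afree); rewrite u0 mul0mx.
move/rowP/(_ (enum_rank_in roX (r o))); rewrite !mxE enum_rankK_in //.
rewrite cE ?(strandG (hr _)) // (strand_cl (hr o)) eqxx (negPf oo') subr0.
by move/eqP; rewrite oner_eq0.
Qed.

End Theta.

(** * Bounded monomials modulo an ideal *)

Section InIdeal.
Local Open Scope ring_scope.
Context {m : nat} {k : fieldType} (gens : seq {mpoly k[m]}).

Lemma in_ideal0 : in_ideal gens 0.
Proof.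
(* Coefficients past the end of the list read as 0. *)
exists [::]; rewrite big1 // => i _.
by rewrite nth_nil mul0r.
Qed.

Lemma in_idealD f g : in_ideal gens f -> in_ideal gens g -> in_ideal gens (f + g).
Proof.
move=> [c ->] [d ->]; exists (mkseq (fun i => c`_i + d`_i) (size gens)).
rewrite -big_split /=; apply: eq_bigr => i _.
by rewrite nth_mkseq // mulrDl.
Qed.

Lemma in_idealM f g : in_ideal gens g -> in_ideal gens (f * g).
Proof.
move=> [c ->]; exists (mkseq (fun i => f * c`_i) (size gens)).
rewrite mulr_sumr; apply: eq_bigr => i _.
by rewrite nth_mkseq // mulrA.
Qed.

Lemma in_ideal_gen g : g \in gens -> in_ideal gens g.
Proof.
move=> gG; have ig : (index g gens < size gens)%N by rewrite index_mem.
exists (mkseq (fun i => (i == index g gens)%:R) (size gens)).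
rewrite (bigD1 (Ordinal ig)) //= nth_mkseq // eqxx mul1r nth_index // big1 ?addr0 //.
move=> i ii; rewrite nth_mkseq // -[index _ _]/(val (Ordinal ig)) (inj_eq val_inj).
by rewrite (negPf ii) mul0r.
Qed.

Lemma in_ideal_ind (P : {mpoly k[m]} -> Prop) : P 0 ->
  (forall f g, P f -> P g -> P (f + g)) ->
  (forall c g, g \in gens -> P (c * g)) ->
  forall f, in_ideal gens f -> P f.
Proof.
move=> P0 PD PM f [c ->]; elim/big_ind: _ => // i _.
by apply: PM; rewrite mem_nth.
Qed.
End InIdeal.

Section BoundedMonomials.
Local Open Scope ring_scope.
Context {m n : nat} {k : fieldType} (io : 'I_n.+1 -> 'I_m) (io_inj : injective io).
Context (b : 'I_n.+1 -> nat) (b_gt0 : forall i, (0 < b i)%N).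

Definition on_io (mm : 'X_{1..m}) := forall j, (forall i, j <> io i) -> mm j = 0%N.

Definition bounded (mm : 'X_{1..m}) := on_io mm /\ forall i, (mm (io i) < b i)%N.

Local Notation y i := ('X_(io i) : {mpoly k[m]}).
Local Notation i0 := (io ord0).

(** * Spanning: reduction of every polynomial to bounded monomials *)

Section Spanning.
Context (I : {mpoly k[m]} -> Prop) (I0 : I 0).
Context (ID : forall f g, I f -> I g -> I (f + g)).
Context (IM : forall f g, I g -> I (f * g)).
Context (lin : forall l, exists c : 'I_n.+1 -> k, I ('X_l - \sum_i c i *: y i)).
Context (pow : forall i, i != ord0 -> I (y i ^+ b i)).
Context (pow0 : I ((\sum_i y i) ^+ b ord0)).

Definition spanned f := exists g, (forall mm, mm \in msupp g -> bounded mm) /\ I (f - g).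

Lemma spannedD f g : spanned f -> spanned g -> spanned (f + g).
Proof.
move=> [f' [hf If]] [g' [hg Ig]]; exists (f' + g'); split.
  by move=> mm /msuppD_le; rewrite mem_cat => /orP[/hf|/hg].
by rewrite opprD addrACA; exact: ID.
Qed.

Lemma spannedZ c f : spanned f -> spanned (c *: f).
Proof.
move=> [f' [hf If]]; exists (c *: f'); split; first by move=> mm /msuppZ_le/hf.
by rewrite -scalerBr -mul_mpolyC; exact: IM.
Qed.

Lemma spanned_I f : I f -> spanned f.
Proof. by move=> If; exists 0; rewrite subr0; split=> // mm; rewrite msupp0. Qed.

Lemma spanned0 : spanned 0. Proof. exact: spanned_I. Qed.

Lemma spanned_bounded mm : bounded mm -> spanned 'X_[mm].
Proof.
move=> bm; exists 'X_[mm]; rewrite subrr; split=> // mm'.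
by rewrite msuppX inE => /eqP->.
Qed.

Lemma spanned_sum (J : Type) (r : seq J) (P : pred J) (F : J -> {mpoly k[m]}) :
  (forall j, P j -> spanned (F j)) -> spanned (\sum_(j <- r | P j) F j).
Proof. by move=> h; apply: big_ind => //; [exact: spanned0|exact: spannedD]. Qed.

(** Since [I] absorbs multiples, [f] may be replaced by a congruent combination of bounded
    monomials. *)
Lemma spanned_mul u : (forall mm, bounded mm -> spanned (u * 'X_[mm])) ->
  forall f, spanned f -> spanned (u * f).
Proof.
move=> hu f [g [hg If]]; rewrite -(subrK g f) mulrDr; apply: spannedD.
  by apply: spanned_I; exact: IM.
rewrite [g]mpolyE mulr_sumr big_seq; apply: spanned_sum => mm mg.
by rewrite -scalerAr; apply: spannedZ; apply: hu; exact: hg.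
Qed.

Lemma bounded_succ i mm : bounded mm -> ((mm (io i)).+1 < b i)%N ->
  bounded (U_(io i) + mm).
Proof.
move=> [h1 h2] hi; split=> [j hj|i'].
  by rewrite mnmDE mnm1E h1 // addn0; case: eqVneq => // e; case: (hj i).
rewrite mnmDE mnm1E (inj_eq io_inj); case: eqVneq => [<-//|_]; exact: h2.
Qed.

Lemma mpolyX_split j (mm : 'X_{1..m}) :
  exists mm' : 'X_{1..m}, [/\ 'X_[mm] = 'X_j ^+ mm j * 'X_[mm'] :> {mpoly k[m]},
     mm' j = 0%N & forall l, l != j -> mm' l = mm l].
Proof.
exists [multinom (if l == j then 0%N else mm l) | l < m]; split.
- rewrite mpolyXn -mpolyXD; congr 'X_[_]; apply/mnmP => l.
  rewrite mnmDE mulmnE mnm1E mnmE eq_sym; case: eqVneq => [->|_].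
    by rewrite mul1n addn0.
  by rewrite mul0n.
- by rewrite mnmE eqxx.
- by move=> l /negPf lj; rewrite mnmE lj.
Qed.

(** When the exponent of [y i] reaches its bound, the product is a multiple of [y i ^+ b i] and lies
    in [I]. *)
Lemma spanned_mul_var i : i != ord0 -> forall f, spanned f -> spanned (y i * f).
Proof.
move=> i_n0; apply: spanned_mul => mm bm; case: (bm) => h1 h2.
case: (ltnP (mm (io i)).+1 (b i)) => hi.
  by rewrite -mpolyXD; apply/spanned_bounded/bounded_succ.
have eb : b i = (mm (io i)).+1 by apply/eqP; rewrite eqn_leq hi h2.
have [mm' [-> _ _]] := mpolyX_split (io i) mm.
by apply: spanned_I; rewrite mulrA -exprS -eb mulrC; apply/IM/pow.
Qed.

Lemma spanned_mul_tail d f : spanned f ->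
  spanned ((\sum_(i | i != ord0) y i) ^+ d * f).
Proof.
move=> sf; elim: d => [|d IH]; first by rewrite mul1r.
rewrite exprS -mulrA mulr_suml; apply: spanned_sum => i i_n0.
exact: spanned_mul_var.
Qed.

(* At the bound, y_0^b is rewritten with the binomial expansion of (y_0 + tail)^b. *)
Lemma spanned_mul_var0 f : spanned f -> spanned (y ord0 * f).
Proof.
apply: spanned_mul => mm bm; case: (bm) => h1 h2.
case: (ltnP (mm i0).+1 (b ord0)) => hi.
  by rewrite -mpolyXD; apply/spanned_bounded/bounded_succ.
have eb : b ord0 = (mm i0).+1 by apply/eqP; rewrite eqn_leq hi h2.
have [mm' [-> m0 mE]] := mpolyX_split i0 mm.
rewrite mulrA -exprS -eb; set z := y ord0.
pose t := \sum_(i | i != ord0) y i.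
have zt : \sum_i y i = t + z by rewrite (bigD1 ord0) //= addrC.
have := pow0; rewrite zt exprDn big_ord_recr /= subnn expr0 mul1r binn mulr1n => It.
(* With S the rest of the binomial expansion, z^b = -S + (S + z^b), and the bracket lies in [I]. *)
rewrite -[z ^+ _](addKr (\sum_(i < b ord0) (t ^+ (b ord0 - i) * z ^+ i) *+ 'C(b ord0, i))).
rewrite mulrDl; apply: spannedD; last first.
  by apply: spanned_I; rewrite mulrC; apply: IM.
rewrite -mulN1r -mulrA mulN1r -scaleN1r; apply: spannedZ.
rewrite mulr_suml; apply: spanned_sum => d _.
rewrite -scaler_nat -scalerAl; apply: spannedZ; rewrite -mulrA.
(* In a term of S the exponent of [z] is below its bound, so this monomial is bounded; the power of
   [t] only involves variables already treated. *)
apply: spanned_mul_tail; rewrite mpolyXn -mpolyXD; apply: spanned_bounded; split.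
  move=> j hj; rewrite mnmDE mulmnE mnm1E mE ?h1 //; last by apply/eqP.
  by case: eqVneq => // ej; case: (hj ord0).
move=> i; rewrite mnmDE mulmnE mnm1E (inj_eq io_inj); case: eqVneq => [<-|i_n0].
  by rewrite mul1n m0 addn0.
by rewrite mul0n add0n mE ?h2 // (inj_eq io_inj) eq_sym.
Qed.

(** Multiplication by any variable preserves [spanned], as [lin] trades it for chosen variables.
    Monomials are then built from 1, which is bounded because the bounds are positive. *)
Lemma spanned_all f : spanned f.
Proof.
have hX l g : spanned g -> spanned ('X_l * g).
  move=> sg; have [c Ic] := lin l.
  rewrite -(subrK (\sum_i c i *: y i) 'X_l) mulrDl; apply: spannedD.
    by apply: spanned_I; rewrite mulrC; apply: IM.
  rewrite mulr_suml; apply: spanned_sum => i _; rewrite -scalerAl; apply: spannedZ.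
  by case: (eqVneq i ord0) => [->|i_n0]; [exact: spanned_mul_var0|exact: spanned_mul_var].
have hXn l d g : spanned g -> spanned ('X_l ^+ d * g).
  by move=> sg; elim: d => [|d IH]; rewrite ?mul1r // exprS -mulrA; apply: hX.
have s1 : spanned 1.
  rewrite -mpolyX0; apply: spanned_bounded; split=> [j _|i]; rewrite mnm0E //.
rewrite [f]mpolyE; apply: spanned_sum => mm _; apply: spannedZ.
rewrite mpolyXE_id; elim/big_rec: _ => // l g _; exact: hXn.
Qed.
End Spanning.

(** * Independence of the bounded monomials *)

Section Independence.
Context (h : m.-tuple {mpoly k[m]}).
Context (h_var : forall i, i != ord0 -> tnth h (io i) = y i).
Context (h_var0 : tnth h i0 = - \sum_i y i).

Definition degle d (f : {mpoly k[m]}) := forall mm, mm \in msupp f -> (mm i0 <= d)%N.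

(** Bounding the support lets the zero polynomial satisfy [deglt 0], the start of the induction in
    [sum_pow_top]. *)
Definition deglt d (f : {mpoly k[m]}) := forall mm, mm \in msupp f -> (mm i0 < d)%N.

Lemma degltD d f g : deglt d f -> deglt d g -> deglt d (f + g).
Proof. by move=> hf hg mm /msuppD_le; rewrite mem_cat => /orP[/hf|/hg]. Qed.

Lemma degltM d d' f g : deglt d f -> degle d' g -> deglt (d + d') (f * g).
Proof.
move=> hf hg mm /msuppM_le/allpairsP[[m1 m2] /= [/hf h1 /hg h2 ->]].
by rewrite mnmDE -addSn leq_add.
Qed.

Lemma degle_sum : degle 1 (\sum_i y i).
Proof.
move=> mm /msupp_sum_le/flatten_mapP[i _]; rewrite msuppX inE => /eqP->.
by rewrite mnm1E leq_b1.
Qed.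

(** With S the whole sum, z its distinguished variable and t the rest, S^(d+1) - z^(d+1) = (S^d -
    z^d) S + t z^d, and t is free of z. *)
Lemma sum_pow_top d : deglt d ((\sum_i y i) ^+ d - y ord0 ^+ d).
Proof.
elim: d => [|d IH]; first by rewrite subrr => mm; rewrite msupp0.
pose t := \sum_(i | i != ord0) y i.
have zt : \sum_i y i = y ord0 + t by rewrite (bigD1 ord0).
have -> : (\sum_i y i) ^+ d.+1 - y ord0 ^+ d.+1 =
    ((\sum_i y i) ^+ d - y ord0 ^+ d) * (\sum_i y i) + t * y ord0 ^+ d.
  rewrite mulrBl -exprSr -addrA; congr (_ + _).
  by rewrite zt mulrDr opprD -exprSr [t * _]mulrC subrK.
apply: degltD; first by rewrite -addn1; apply: degltM => //; exact: degle_sum.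
rewrite -add1n.
apply: degltM => mm; last by rewrite mpolyXn msuppX inE => /eqP->; rewrite mulmnE mnm1E eqxx mul1n.
move=> /msupp_sum_le/flatten_mapP[i]; rewrite mem_filter => /andP[i_n0 _].
by rewrite msuppX inE => /eqP->; rewrite mnm1E (inj_eq io_inj) (negPf i_n0).
Qed.

(* The substitution is triangular for the degree in the distinguished variable. *)
Lemma comp_mpoly_top mm : on_io mm ->
  deglt (mm i0) ('X_[mm] \mPo h - (-1) ^+ mm i0 *: 'X_[mm]).
Proof.
move=> mio; have [mm' [eX m0 mE]] := mpolyX_split i0 mm.
have cm' : 'X_[mm'] \mPo h = 'X_[mm'].
  rewrite comp_mpolyX [RHS]mpolyXE_id; apply: eq_bigr => l _.
  case: (eqVneq l i0) => [->|l0]; first by rewrite m0.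
  case: (pickP (fun i => io i == l)) => [i /eqP il|nio].
    by rewrite -il h_var //; apply: contraNneq l0 => <-; rewrite il.
  by rewrite mE // mio // => i /eqP; rewrite eq_sym nio.
have ci0 : 'X_i0 \mPo h = - \sum_i y i by rewrite comp_mpolyXU -tnth_nth.
rewrite eX rmorphM rmorphXn /= ci0 cm' [(- \sum_i _) ^+ _]exprNn.
have -> : (-1) ^+ mm i0 * (\sum_i y i) ^+ mm i0 * 'X_[mm'] -
   (-1) ^+ mm i0 *: (y ord0 ^+ mm i0 * 'X_[mm']) =
   (-1) ^+ mm i0 *: (((\sum_i y i) ^+ mm i0 - y ord0 ^+ mm i0) * 'X_[mm']) .
  rewrite mulrBl scalerBr -mulrA; congr (_ - _).
  by rewrite -[(-1) ^+ _ *: _]mul_mpolyC rmorphXn /= rmorphN1.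
have top : deglt (mm i0 + 0)
    (((\sum_i y i) ^+ mm i0 - y ord0 ^+ mm i0) * 'X_[mm']).
  apply: degltM; first exact: sum_pow_top.
  by move=> mm2; rewrite msuppX inE => /eqP->; rewrite m0.
by move=> mm2 /msuppZ_le/top; rewrite addn0.
Qed.

(** Take [mm] in the support of [g] with the largest distinguished exponent. By triangularity its
    coefficient survives in [g \mPo h] up to sign, so the bounded [mm] would reach a bound. *)
Lemma bounded_free g : (forall mm, mm \in msupp g -> bounded mm) ->
  (forall mm, mm \in msupp (g \mPo h) -> exists i, (b i <= mm (io i))%N) -> g = 0.
Proof.
move=> gb gh; apply/eqP; rewrite -msupp_eq0; apply/eqP.
case E : (msupp g) => [//|mm0 r0].
have [mm mg mmax] : exists2 mm, mm \in msupp g &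
    forall mm', mm' \in msupp g -> (mm' i0 <= mm i0)%N.
  rewrite E; elim: r0 mm0 {E} => [|m1 r IH] mm0.
    by exists mm0; rewrite ?inE // => mm'; rewrite inE => /eqP->.
  have [mm mg mmax] := IH m1.
  case: (leqP (mm0 i0) (mm i0)) => hle.
    by exists mm => [|mm']; rewrite inE ?mg ?orbT // => /orP[/eqP->|/mmax].
  exists mm0 => [|mm']; rewrite inE ?eqxx // => /orP[/eqP->//|/mmax h'].
  exact: leq_trans h' (ltnW hle).
have cf mm' : mm' \in msupp g -> ('X_[mm'] \mPo h)@_mm = (-1) ^+ mm i0 * (mm' == mm)%:R.
  move=> m'g; have [mio _] := gb _ m'g; have := comp_mpoly_top mio.
  rewrite -[X in X@__](subrK ((-1) ^+ mm' i0 *: 'X_[mm'])) => lt.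
  rewrite mcoeffD mcoeffZ mcoeffX memN_msupp_eq0 ?add0r.
    by case: eqVneq => [->|]; rewrite ?mulr0.
  by apply/negP => /lt; rewrite ltnNge mmax.
have : mm \in msupp (g \mPo h).
  rewrite mcoeff_msupp comp_mpolyEX raddf_sum /= (big_rem mm) //=.
  rewrite mcoeffZ cf // eqxx mulr1 big_seq big1 ?addr0.
    by rewrite mulf_neq0 -?mcoeff_msupp // signr_eq0.
  move=> mm'; rewrite (rem_filter _ (msupp_uniq g)) mem_filter => /andP[/= ne m'g].
  by rewrite mcoeffZ cf // (negPf ne) !mulr0.
have [_ mb] := gb _ mg.
by case/gh => i; rewrite leqNgt mb.
Qed.
End Independence.
End BoundedMonomials.

(** * The ordered ground set *)

Section ThetaOrder.
Context {T : finType} (n : nat) (G : {set T}) (cl : T -> 'I_n.+2).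
Context (strand_neq0 : forall o, exists x, x \in strand G cl o).
Context (strand0_uniq : forall x y,
  x \in strand G cl ord0 -> y \in strand G cl ord0 -> x = y).
Context (m s : nat) (e : 'I_m -> T) (ms : m - s = n.+1).
Context (e_inj : injective e) (e_im : e @: setT = G).
Context (e_cl : forall i : 'I_m, i < n.+1 -> cl (e i) = i :> nat).

Local Notation strand := (strand G cl).
Local Notation N := (theta_matroid G cl).
Local Notation B := (last_basis e s).

(** Labels of all strands but the last. [low i] is the strand of the chosen element at position
    [io i]; these positions are exactly those outside the basis. *)
Definition low (i : 'I_n.+1) : 'I_n.+2 := widen_ord (leqnSn _) i.

Lemma leq_nm : n.+1 <= m. Proof. by rewrite -ms leq_subr. Qed.
Definition io (i : 'I_n.+1) : 'I_m := widen_ord leq_nm i.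

Lemma lowVmax (o : 'I_n.+2) : (exists i, o = low i) \/ o = ord_max.
Proof.
have := ltn_ord o; rewrite ltnS leq_eqVlt => /orP[/eqP h|h]; last first.
  by left; exists (Ordinal h); apply: val_inj.
by right; apply: val_inj.
Qed.

Lemma low_inj : injective low.
Proof. by move=> i j /(congr1 val) /= ij; apply: val_inj. Qed.

Lemma low_neq_max i : low i != ord_max.
Proof. by apply/eqP => /(congr1 val) /= h; have := ltn_ord i; rewrite h ltnn. Qed.

Lemma cl_io i : cl (e (io i)) = low i.
Proof. by apply: val_inj => /=; rewrite e_cl /=. Qed.

Lemma eG i : e i \in G.
Proof. by rewrite -e_im imset_f. Qed.

Lemma e_surj x : x \in G -> exists i, x = e i.
Proof. by rewrite -e_im => /imsetP[i _ ->]; exists i. Qed.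

Lemma idxVio (l : 'I_m) : (exists i, l = io i) \/ n.+1 <= l.
Proof.
case: (ltnP l n.+1) => h; last by right.
by left; exists (Ordinal h); apply: val_inj.
Qed.

Lemma e_in_strand l o : (e l \in strand o) = (cl (e l) == o).
Proof. by rewrite in_strand eG. Qed.

Lemma in_last_basis l : (e l \in B) = (n.+1 <= l).
Proof.
apply/imsetP/idP => [[i]|h]; last by exists l; rewrite // inE ms.
by rewrite inE ms => h /e_inj->.
Qed.

(** An instance of [theta_basis] that keeps the last strand full and removes the chosen elements. *)
Lemma last_basisP : is_basis N B.
Proof.
pose r (o : 'I_n.+2) := if (o < n.+1)%N then e (io (inord o)) else xchoose (strand_neq0 o).
have hr o : r o \in strand o.
  rewrite /r; case: ifP => h; last exact: (xchooseP (strand_neq0 o)).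
  by rewrite e_in_strand cl_io; apply/eqP/val_inj; rewrite /= inordK.
have := theta_basis ord_max hr; congr is_basis.
apply/setP => x; rewrite inE.
case: (boolP (x \in G)) => [/e_surj[l ->]|xG]; last first.
  rewrite andbF; apply/esym/negP => /imsetP[i _ xe].
  by rewrite xe eG in xG.
rewrite andbT in_last_basis ltnNge; congr negb.
apply/imsetP/idP => [[o]|ln].
  rewrite inE; case: (lowVmax o) => [[i ->] _|->]; last by rewrite eqxx.
  by rewrite /r /= ltn_ord => /e_inj->; rewrite /= -ltnS ltn_ord.
exists (low (inord l)); first by rewrite inE low_neq_max.
rewrite /r /= ltn_ord; congr e; apply: val_inj => /=.
by rewrite !inordK ?ltn_ord.
Qed.

(** * Fundamental cocircuits and circuits *)

Lemma coc_support (D : {set T}) l x : D \subset (G :\: B) :|: [set e l] -> x \in D ->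
  x = e l \/ exists i, x = e (io i).
Proof.
move=> /subsetP h /h; rewrite !inE => /orP[/andP[xB /e_surj[j xe]]|/eqP]; last by left.
right; case: (idxVio j) => [[i ji]|ji]; first by exists i; rewrite xe ji.
by rewrite xe in_last_basis ji in xB.
Qed.

Lemma coc_supportN l x : x \in G ->
  x = e l \/ (exists i, x = e (io i)) -> x \in (G :\: B) :|: [set e l].
Proof.
move=> xG [->|[i ->]]; rewrite !inE ?eqxx ?orbT // in_last_basis eG andbT.
by rewrite -ltnNge (ltn_ord i).
Qed.

Lemma card_classes : 1 < #|'I_n.+2|. Proof. by rewrite card_ord. Qed.

(** No transversal fits, since neither [e l] nor any chosen element lies in the last strand. In a
    pair, the partner of [e l] must be the chosen element of its strand. *)
Lemma fund_cocircuit_low (l : 'I_m) i : n.+1 <= l -> cl (e l) = low i ->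
  fund_cocircuit N B (e l) = [set e l; e (io i)].
Proof.
move=> nl cli.
have lio j : e l != e (io j).
  by apply: contraTneq nl => /e_inj->; rewrite -ltnNge (ltn_ord j).
rewrite /fund_cocircuit; case: pickP => [D|/(_ [set e l; e (io i)])] /=.
  case/and3P=> /(theta_cocircuitP strand_neq0 _ card_classes) hD /coc_support sD lD.
  have iD j : e (io j) \in D -> cl (e (io j)) = cl (e l) -> io j = io i.
    by move=> _; rewrite cl_io cli => /low_inj->.
  case: hD => [[x [y [xG yG xy cxy eD]]]|[r [hr eD]]].
    have xD : x \in D by rewrite eD !inE eqxx.
    have yD : y \in D by rewrite eD !inE eqxx orbT.
    move: lD; rewrite {1}eD !inE => /orP[]/eqP lx; subst.
      case: (sD _ yD) => [yl|[j yj]]; first by rewrite yl eqxx in xy.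
      by rewrite yj (iD j) // -yj.
    case: (sD _ xD) => [yl|[j yj]]; first by rewrite yl eqxx in xy.
    by rewrite yj setUC (iD j) // -yj.
  have rD : r ord_max \in D by rewrite eD imset_f.
  have cr := strand_cl (hr ord_max).
  case: (sD _ rD) => [rl|[j rj]].
    by have := low_neq_max i; rewrite -cli -rl cr eqxx.
  by have := low_neq_max j; rewrite -cl_io -rj cr eqxx.
move=> /negP; case; apply/and3P; split.
- apply/(theta_cocircuitP strand_neq0 _ card_classes); left.
  by exists (e l), (e (io i)); rewrite !eG cl_io cli lio.
- apply/subsetP => x; rewrite in_set2 => /orP[]/eqP->; apply: coc_supportN; rewrite ?eG //.
    by left.
  by right; exists i.
by rewrite !inE eqxx.
Qed.

Lemma max_transversal l : cl (e l) = ord_max ->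
  exists2 r : 'I_n.+2 -> T, (forall o, r o \in strand o) &
    e l |: [set e (io i) | i : 'I_n.+1] = [set r o | o : 'I_n.+2].
Proof.
move=> cll.
exists (fun o : 'I_n.+2 => if o < n.+1 then e (io (inord o)) else e l).
  move=> o; case: (lowVmax o) => [[i ->]|->] /=; rewrite ?ltn_ord ?ltnn e_in_strand.
    by rewrite inord_val cl_io.
  by rewrite cll.
apply/eqP; rewrite eqEsubset; apply/andP; split; apply/subsetP => x.
  rewrite !inE => /orP[/eqP->|/imsetP[i _ ->]]; apply/imsetP.
    by exists ord_max => //=; rewrite ltnn.
  by exists (low i) => //=; rewrite ltn_ord inord_val.
move=> /imsetP[o _ ->]; case: ifP => _; last by rewrite !inE eqxx.
by rewrite !inE imset_f ?orbT.
Qed.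

(** [e l] is the only available element of the last strand, so it has no partner for a pair, and a
    transversal must use every chosen element. *)
Lemma fund_cocircuit_max l : cl (e l) = ord_max ->
  fund_cocircuit N B (e l) = e l |: [set e (io i) | i : 'I_n.+1].
Proof.
move=> cll.
have lio j : e l != e (io j).
  apply/eqP => h; have := low_neq_max j.
  by rewrite -cl_io -h cll eqxx.
rewrite /fund_cocircuit; case: pickP => [D|/(_ (e l |: [set e (io i) | i : 'I_n.+1]))] /=.
  case/and3P=> /(theta_cocircuitP strand_neq0 _ card_classes) hD /coc_support sD lD.
  have pairF x : x \in D -> cl x = ord_max -> x = e l.
    case/sD => // -[i xi] cx; have := low_neq_max i.
    by rewrite -cl_io -xi cx eqxx.
  case: hD => [[x [y [xG yG xy cxy eD]]]|[r [hr eD]]].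
    have xD : x \in D by rewrite eD !inE eqxx.
    have yD : y \in D by rewrite eD !inE eqxx orbT.
    case/eqP: xy; move: lD; rewrite {1}eD !inE => /orP[]/eqP lx; subst.
      by apply/esym/pairF; rewrite -?cxy.
    by apply/pairF; rewrite ?cxy.
  have rD o : r o \in D by rewrite eD imset_f.
  have rmax : r ord_max = e l by apply: pairF; rewrite ?(strand_cl (hr _)).
  have rlow i : r (low i) = e (io i).
    case: (sD _ (rD (low i))) => [h|[j h]].
      by have := low_neq_max i; rewrite -(strand_cl (hr (low i))) h cll eqxx.
    have := strand_cl (hr (low i)); rewrite h cl_io => /low_inj->; by [].
  apply/eqP; rewrite eqEsubset; apply/andP; split; apply/subsetP => x.
    rewrite {1}eD => /imsetP[o _ ->]; case: (lowVmax o) => [[i ->]|->].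
      by rewrite rlow !inE imset_f ?orbT.
    by rewrite rmax !inE eqxx.
  rewrite !inE => /orP[/eqP->//|/imsetP[i _ ->]].
  by rewrite -rlow.
move=> /negP; case; apply/and3P; split.
- apply/(theta_cocircuitP strand_neq0 _ card_classes); right.
  by have [r hr ->] := max_transversal cll; exists r.
- apply/subsetP => x; rewrite in_setU1 => /orP[/eqP->|/imsetP[i _ ->]];
    apply: coc_supportN; rewrite ?eG //.
    by left.
  by right; exists i.
by rewrite !inE eqxx.
Qed.

(** The basis contains the last strand and misses one element of each other strand, so adding
    [e (io i)] fills only [low i]. *)
Lemma fund_circuit_io i :
  fund_circuit N B (e (io i)) = strand (low i) :|: strand ord_max.
Proof.
have sub o : strand o \subset e (io i) |: B -> o = low i \/ o = ord_max.
  move=> /subsetP h; case: (lowVmax o) => [[j oj]|]; last by right.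
  left; have := h (e (io j)); rewrite e_in_strand cl_io oj eqxx => /(_ isT).
  rewrite !inE in_last_basis leqNgt (ltn_ord j) orbF => /eqP/e_inj/(congr1 val)/= ji.
  by congr low; apply: val_inj.
rewrite /fund_circuit; case: pickP => [C /andP[/theta_circuitP[o [o' [oo' ->]]]]|].
  rewrite subUset => /andP[/sub ho /sub ho'] /=.
  move: oo'; case: ho => ->; case: ho' => ->; rewrite ?eqxx // => _.
  by rewrite setUC.
move=> /(_ (strand (low i) :|: strand ord_max)) /negP[]; apply/andP; split.
  by apply/theta_circuitP; exists (low i), ord_max; rewrite low_neq_max.
apply/subsetP => x xC; have /e_surj[l xl] : x \in G.
  by move: xC; rewrite inE => /orP[]/strandG.
rewrite xl !inE in_last_basis; case: (idxVio l) => [[j lj]|->]; last by rewrite orbT.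
move: xC; rewrite xl inE !e_in_strand lj cl_io (negPf (low_neq_max j)) orbF.
by move=> /eqP/low_inj->; rewrite eqxx.
Qed.

(** * Exponents of the monomials [mC] and description of L *)

Lemma card_idx (A : {set T}) : A \subset G -> #|[set l | e l \in A]| = #|A|.
Proof.
move=> /subsetP AG; rewrite -(card_imset _ e_inj); apply: eq_card => x.
apply/imsetP/idP => [[l + ->]|xA]; first by rewrite inE.
by have [l xl] := e_surj (AG _ xA); exists l; rewrite // inE -xl.
Qed.

Lemma strand_subG o : strand o \subset G.
Proof. by apply/subsetP => x /strandG. Qed.

(** The first positions carry the strand labels in increasing order, so the minimum of the circuit
    is the chosen element of its smaller label. *)
Lemma cbarE i (o : 'I_n.+2) : low i < o ->
  cbar e (strand (low i) :|: strand o) =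
  [set l | e l \in strand (low i) :|: strand o] :\ io i.
Proof.
move=> io_lt; have [C eC] : exists C, C = strand (low i) :|: strand o by eexists.
rewrite -eC; apply/setP => l; rewrite /cbar in_set in_setD1 in_set [RHS]andbC.
case: (boolP (e l \in C)) => [|//] /=; rewrite eC => lC.
apply/existsP/idP => [[j /andP[jC jl]]|li]; last first.
  exists (io i); rewrite inE e_in_strand cl_io eqxx /=.
  case: (idxVio l) => [[j lj]|nl]; last exact: leq_trans (ltn_ord i) nl.
  move: li lC; rewrite lj !inE !eG /= !cl_io => /eqP li.
  case/orP=> /eqP; first by move=> /low_inj ji; case: li; rewrite ji.
  by move=> h; rewrite -h in io_lt.
apply/eqP => li; move: jl; rewrite li /= => ji.
have jn : j < n.+1 by apply: ltn_trans ji (ltn_ord i).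
move: jC; rewrite inE !e_in_strand => /orP[]/eqP/(congr1 val)/=; rewrite e_cl // => jj.
  by rewrite jj ltnn in ji.
by rewrite jj in ji; have := ltn_trans ji io_lt; rewrite ltnn.
Qed.

Lemma strand_sub_cbar i (o : 'I_n.+2) : low i < o ->
  [set l | e l \in strand o] \subset cbar e (strand (low i) :|: strand o).
Proof.
move=> h; rewrite cbarE //; apply/subsetP => l; rewrite in_set => lo.
rewrite in_setD1 in_set in_setU lo orbT andbT; apply: contraTneq lo => ->.
rewrite e_in_strand cl_io; apply: contraTneq h => ->.
by rewrite ltnn.
Qed.

(** The strand with label 0 is a single element and comes first. These circuits yield the power
    generators. *)
Lemma cbar_strand0 (o : 'I_n.+2) : ord0 != o ->
  cbar e (strand ord0 :|: strand o) = [set l | e l \in strand o].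
Proof.
move=> o0; have -> : ord0 = low ord0 by apply: val_inj.
have lt0 : low ord0 < o by rewrite lt0n; apply: contraNneq o0 => h; apply/eqP/val_inj.
apply/eqP; rewrite eqEsubset strand_sub_cbar // andbT cbarE //.
apply/subsetP => l; rewrite in_setD1 !in_set => /andP[l0 /orP[|//]].
have low0 : low ord0 = ord0 by apply: val_inj.
rewrite low0 => h; case/eqP: l0; apply/e_inj/strand0_uniq; rewrite ?inE //.
by rewrite eG cl_io low0 eqxx.
Qed.

Lemma dd_low l i : cl (e l) = low i -> dd N e s l = io i.
Proof.
move=> cli; rewrite /dd ms; case: ltnP => nl.
  case: (idxVio l) => [[j lj]|]; last by rewrite leqNgt nl.
  by move: cli; rewrite lj cl_io => /low_inj->.
case: arg_minnP => [|j]; rewrite /coc_idx (fund_cocircuit_low nl cli) !inE ?eqxx //.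
rewrite !(inj_eq e_inj) => /orP[]/eqP-> // /(_ (io i)).
rewrite !inE eqxx orbT => /(_ isT) /= li.
by have := leq_ltn_trans (leq_trans nl li) (ltn_ord i); rewrite ltnn.
Qed.

(** The last strand has no chosen element, so the variable of [p], whose own strand is a singleton,
    takes over its size. *)
Definition bound (i : 'I_n.+1) : nat :=
  #|strand (if i == ord0 then ord_max else low i)|.

Lemma bound_gt0 i : 0 < bound i.
Proof.
by rewrite /bound card_gt0; apply/set0Pn; exact: strand_neq0.
Qed.

Lemma card_strand0 : #|strand ord0| = 1.
Proof.
have [x x0] := strand_neq0 ord0; apply/eqP/cards1P; exists x.
apply/setP => y; rewrite in_set1; apply/idP/eqP => [y0|->//].
exact: strand0_uniq.
Qed.

Lemma card_cbar_fund i :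
  #|cbar e (strand (low i) :|: strand ord_max)| =
  (#|strand (low i)| + #|strand ord_max|).-1.
Proof.
rewrite cbarE; last by rewrite /= ltn_ord.
set C := _ :|: _.
have /esym := cardsD1 (io i) [set l | e l \in C].
rewrite in_set in_setU e_in_strand cl_io eqxx add1n card_idx; last first.
  by rewrite subUset !strand_subG.
rewrite cardsU disjoint_setI0 ?cards0 ?subn0 => [<-//|].
rewrite -setI_eq0; apply/eqP/setP => x; rewrite !inE.
apply/negP => /andP[/andP[_ /eqP->] /andP[_]].
by rewrite (negPf (low_neq_max i)).
Qed.

(** The bounds come from the circuits joining strand 0 to another strand. Every circuit respects
    them: a fundamental one has exponent [(#|strand (low i)| + #|strand ord_max|).-1], at least
    [bound i], and a union of two lower strands has exponent at least the size of the later one at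
    its variable. *)
Lemma inLP (mm : 'X_{1..m}) :
  reflect ((forall j : 'I_m, n.+1 <= j -> mm j = 0) /\ forall i, mm (io i) < bound i)
          (inL N e s mm).
Proof.
rewrite /inL ms.
have fundC (j : 'I_m) C : j < n.+1 -> fund_circuit N B (e j) = C ->
    exists2 i, j = io i & C = strand (low i) :|: strand ord_max.
  move=> jn <-; case: (idxVio j) => [[i ->]|]; last by rewrite leqNgt jn.
  by exists i => //; rewrite fund_circuit_io.
apply: (iffP andP) => [[/forallP h1 /forallP h2]|[h1 h2]]; split.
- by move=> j nj; apply/eqP; apply: (implyP (h1 j)).
- move=> i; rewrite ltnNge; apply/negP => bi.
  pose o := if i == ord0 then ord_max else low i.
  have o0 : ord0 != o.
    rewrite /o; case: ifPn => // i0; apply: contraNneq i0 => /(congr1 val) /= e0.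
    by apply/eqP/val_inj.
  have /implyP := h2 (strand ord0 :|: strand o).
  have -> : strand ord0 :|: strand o \in circuits N.
    by apply/theta_circuitP; exists ord0, o.
  move=> /(_ isT)/negP; apply; rewrite /mC ms.
  case: pickP => [j /andP[jn /eqP /(fundC _ _ jn)[i' ji' eC]]|nf].
    have ii' : i = i'.
      have : e (io i') \in strand ord0 :|: strand o.
        by rewrite eC inE e_in_strand cl_io eqxx.
      rewrite inE !e_in_strand cl_io => /orP[]/eqP; rewrite /o.
        move=> /(congr1 val)/= i'0.
        have : strand o \subset strand (low i') :|: strand ord_max.
          by rewrite -eC subsetUr.
        rewrite /o; case: eqVneq => [->|i0] /subsetP; first by move=> _; apply: val_inj.
        move=> /(_ (e (io i))); rewrite in_setU !e_in_strand !cl_io eqxx => /(_ isT).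
        by rewrite (negPf (low_neq_max i)) orbF => /eqP/low_inj.
      case: eqVneq => [_ h|_ /low_inj//].
      by have := low_neq_max i'; rewrite h eqxx.
    apply/mnm_lepP => j'; rewrite mnmE; case: eqVneq => // ->.
    rewrite ji' -ii' cbar_strand0 // card_idx ?strand_subG //.
  apply/mnm_lepP => j; rewrite mnmE.
  (* For [i = ord0] the circuit is fundamental and belongs to the previous branch. *)
  have i0 : i != ord0.
    apply/eqP => i0; have := nf (io ord0); rewrite fund_circuit_io (ltn_ord (ord0 : 'I_n.+1)) /o i0 eqxx.
    have -> : low ord0 = ord0 by apply: val_inj.
    by rewrite eqxx.
  have oi : o = low i by rewrite /o (negPf i0).
  have ddi l : l \in [set l | e l \in strand o] -> dd N e s l = io i.
    by rewrite in_set e_in_strand oi => /eqP/dd_low.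
  rewrite cbar_strand0 //; case: (eqVneq j (io i)) => [->|ji].
    apply: leq_trans bi; rewrite /bound -/o -card_idx ?strand_subG //.
    by apply/subset_leq_card/subsetP => l; rewrite in_set => /andP[].
  rewrite (_ : [set _ | _] = set0) ?cards0 //; apply/setP => l; rewrite !in_set.
  apply/negP => /andP[lo /eqP ddl]; case/eqP: ji; rewrite -ddl; apply: ddi.
  by rewrite !in_set.
- by apply/forallP => j; apply/implyP => /h1->.
apply/forallP => C; apply/implyP => CN; apply/negP => /mnm_lepP; rewrite /mC ms.
case: pickP => [j /andP[jn /eqP /(fundC _ _ jn)[i ji eC]] /(_ j)|nf hC].
  rewrite mnmE eqxx eC card_cbar_fund ji leqNgt => /negP[].
  apply: leq_trans (h2 i) _; rewrite /bound; case: eqVneq => [->|_].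
    have -> : low ord0 = ord0 by apply: val_inj.
    by rewrite card_strand0 add1n.
  have : 0 < #|strand ord_max| by rewrite card_gt0; apply/set0Pn/strand_neq0.
  by case: #|strand ord_max| => // c _; rewrite addnS leq_addr.
have [i [j [ij eC]]] : exists i j, low i < low j /\ C = strand (low i) :|: strand (low j).
  have nmax i : C <> strand (low i) :|: strand ord_max.
    by move=> h; have := nf (io i); rewrite fund_circuit_io h eqxx (ltn_ord i).
  have /theta_circuitP[o [o' [oo' h]]] := CN.
  case: (lowVmax o) (lowVmax o') => [[i oi]|oi] [[i' oi']|oi']; subst o o'.
  - case: (ltngtP (low i) (low i')) => ii'; [by exists i, i' | | ].
      by exists i', i; rewrite setUC.
    by case/eqP: oo'; apply: val_inj.
  - by case: (nmax i).
  - by case: (nmax i'); rewrite setUC.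
  - by rewrite eqxx in oo'.
have := hC (io j); rewrite mnmE leqNgt => /negP[]; apply: leq_trans (h2 j) _.
rewrite /bound ifN; last by apply: contraTneq ij => ->; rewrite ltn0.
rewrite -card_idx ?strand_subG //; apply/subset_leq_card/subsetP => l lj.
rewrite in_set eC (subsetP (strand_sub_cbar ij)) //=.
by apply/eqP/dd_low/eqP; rewrite -e_in_strand; move: lj; rewrite in_set.
Qed.

(** * The linear forms and the ideal *)

Local Open Scope ring_scope.
Context (k : fieldType).
Local Notation sgn := (cocircuit_sign cl).
Local Notation gens := (ideal_gens N e s k sgn).
Local Notation y i := ('X_(io i) : {mpoly k[m]}).

Lemma io_inj : injective io.
Proof. by move=> i j /(congr1 val) /= ij; apply: val_inj. Qed.

(** The equation [c * c = 1] is what allows the unknown sign to be cancelled by one more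
    multiplication. *)
Lemma theta_low (l : 'I_m) i : (n.+1 <= l)%N -> cl (e l) = low i ->
  exists2 c : k, c * c = 1 & theta N e s k sgn l = c *: ('X_l - y i).
Proof.
move=> nl cli; have lio : l != io i.
  by apply: contraTneq nl => ->; rewrite -ltnNge (ltn_ord i).
have ene : e l != e (io i) by rewrite (inj_eq e_inj).
have cle : cl (e l) = cl (e (io i)) by rewrite cl_io.
have [c [c1 hc]] := cocircuit_sign_pair ene cle.
exists c%:~R; first by case: c1 => ->; rewrite ?mulr1 // -intrM mulrNN mulr1.
rewrite /theta (fund_cocircuit_low nl cli).
rewrite (bigD1 l) ?inE ?eqxx //= (bigD1 (io i)) /=; last first.
  by rewrite !inE eqxx orbT eq_sym.
rewrite big1 => [|j].
  rewrite !hc !eqxx (negPf ene) [e (io i) == _]eq_sym (negPf ene).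
  by rewrite subr0 sub0r mulr1 mulrN1 addr0 intrN scaleNr scalerBr.
rewrite !inE !(inj_eq e_inj) => /andP[/andP[/orP[]/eqP-> //]]; rewrite eqxx //.
Qed.

Lemma theta_max l : cl (e l) = ord_max ->
  theta N e s k sgn l = 'X_l + \sum_i y i.
Proof.
move=> cll; rewrite /theta (fund_cocircuit_max cll).
have lio i : l != io i.
  by apply: contraTneq (low_neq_max i) => li; rewrite -cl_io -li cll eqxx.
rewrite (eq_bigr (fun i => 'X_i)) => [|i iD]; last first.
  have [r hr eD] := max_transversal cll; rewrite eD (cocircuit_sign_transversal _ hr).
  by rewrite -eD iD scale1r.
rewrite (eq_bigl (mem (l |: [set io i | i : 'I_n.+1]))) => [|j]; last first.
  rewrite !inE (inj_eq e_inj); congr (_ || _).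
  apply/imsetP/imsetP => -[i _]; last by move=> ->; exists i.
  by move/e_inj => ->; exists i.
rewrite big_setU1 /=; last by apply/imsetP => -[i _ li]; have := lio i; rewrite li eqxx.
by rewrite big_imset //= => i j _ _; exact: io_inj.
Qed.

Lemma circ_monomial_gen C : C \in circuits N -> circ_monomial e k C \in gens.
Proof. by move=> CN; rewrite mem_cat map_f // mem_enum. Qed.

Lemma theta_gen (l : 'I_m) : (n.+1 <= l)%N -> theta N e s k sgn l \in gens.
Proof.
move=> nl; rewrite mem_cat; apply/orP; right; apply: map_f.
by rewrite mem_filter ms nl mem_enum.
Qed.

Lemma circ_monomialE (C : {set T}) : circ_monomial e k C = \prod_(l in cbar e C) 'X_l.
Proof.
rewrite /circ_monomial mpolyXE_id [RHS]big_mkcond; apply: eq_bigr => l _.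
by rewrite mnmE; case: (l \in _).
Qed.

Lemma var_low l i : cl (e l) = low i -> in_ideal gens ('X_l - y i).
Proof.
move=> cli; case: (idxVio l) => [[j lj]|nl].
  by move: cli; rewrite lj cl_io => /low_inj->; rewrite subrr; exact: in_ideal0.
have [c c1 tc] := theta_low nl cli.
rewrite -[X in in_ideal _ X]scale1r -c1 -scalerA -tc -mul_mpolyC.
by apply/in_idealM/in_ideal_gen/theta_gen.
Qed.

Lemma max_idx l : cl (e l) = ord_max -> (n.+1 <= l)%N.
Proof.
case: (idxVio l) => [[j ->]|//]; rewrite cl_io => h.
by have := low_neq_max j; rewrite h eqxx.
Qed.

Lemma var_max l : cl (e l) = ord_max -> in_ideal gens ('X_l - - \sum_i y i).
Proof.
move=> cll; rewrite opprK -theta_max //.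
exact/in_ideal_gen/theta_gen/max_idx.
Qed.

Lemma in_idealB f g : in_ideal gens f -> in_ideal gens g -> in_ideal gens (f - g).
Proof.
move=> If Ig; apply: in_idealD => //.
by rewrite -mulN1r; apply: in_idealM.
Qed.

(** The monomial of the circuit joining strand 0 to [o] is the product of the variables of [o], each
    congruent to [u]. *)
Lemma pow_in_ideal o u : ord0 != o ->
  (forall l, cl (e l) = o -> in_ideal gens ('X_l - u)) ->
  in_ideal gens (u ^+ #|strand o|).
Proof.
move=> o0 hu; have : circ_monomial e k (strand ord0 :|: strand o) \in gens.
  by apply/circ_monomial_gen/theta_circuitP; exists ord0, o.
move/in_ideal_gen; rewrite circ_monomialE cbar_strand0 // => IC.
rewrite -card_idx ?strand_subG // -prodr_const.
rewrite -[X in in_ideal _ X](subKr (\prod_(l in [set l | e l \in strand o]) 'X_l)).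
apply: in_idealB => //; elim/big_rec2: _ => [|l f g]; first by rewrite subrr; exact: in_ideal0.
rewrite in_set => /strand_cl/hu Il Ifg.
(* The two products are compared one factor at a time. *)
rewrite -(subrK (u * g) ('X_l * g)) -addrA -mulrBl -mulrBr.
apply: in_idealD; last exact: in_idealM.
by rewrite mulrC; apply: in_idealM.
Qed.

Lemma inL_bounded mm : inL N e s mm <-> bounded io bound mm.
Proof.
split=> [/inLP[h1 h2]|[h1 h2]]; first split=> // j hj.
  by apply: h1; case: (idxVio j) => // -[i ji]; case: (hj i).
apply/inLP; split=> // j nj; apply: h1 => i ji.
by move: nj; rewrite ji leqNgt (ltn_ord i).
Qed.

Lemma theta_L_spans f : exists g, (forall mm, mm \in msupp g -> inL N e s mm) /\
  in_ideal gens (f - g).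
Proof.
have [g [hg Ig]] : spanned io bound (in_ideal gens) f; last first.
  by exists g; split=> // mm /hg/inL_bounded.
apply: spanned_all.
- exact: io_inj.
- exact: bound_gt0.
- exact: in_ideal0.
- exact: in_idealD.
- by move=> f' g; exact: in_idealM.
- move=> l; case: (lowVmax (cl (e l))) => [[i cli]|cll].
    exists (fun j => (j == i)%:R).
    rewrite (bigD1 i) //= eqxx scale1r big1 ?addr0; first exact: var_low.
    by move=> j /negPf->; rewrite scale0r.
  exists (fun=> -1); rewrite (eq_bigr (fun i => - y i)) => [|i _].
    by rewrite sumrN; exact: var_max.
  by rewrite scaleN1r.
- move=> i i_n0; rewrite /bound (negPf i_n0); apply: pow_in_ideal.
    by apply: contraNneq i_n0 => /(congr1 val) /= h; apply/eqP/val_inj.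
  by move=> l; exact: var_low.
(* The last strand is congruent to minus the sum, so a sign is inserted twice and one copy is
   absorbed into the power. *)
rewrite /bound eqxx -[X in in_ideal _ X]mul1r -(signrMK #|strand ord_max| 1) mulr1.
rewrite -mulrA -exprNn.
by apply/in_idealM/pow_in_ideal => // l; exact: var_max.
Qed.

(* New coordinates: u_0 is the common image of the variables of the last strand,
   u_i that of strand i; the ideal becomes generated by powers of the u_i. *)
Definition strand_image (o : 'I_n.+2) : {mpoly k[m]} :=
  if o == ord0 then - \sum_i y i
  else y (if o == ord_max then ord0 else inord o).

Definition images : m.-tuple {mpoly k[m]} := [tuple strand_image (cl (e l)) | l < m].

Lemma imagesE l : 'X_l \mPo images = strand_image (cl (e l)).
Proof. by rewrite comp_mpolyXU -tnth_nth tnth_mktuple. Qed.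

Lemma strand_image_low i : i != ord0 -> strand_image (low i) = y i.
Proof.
by move=> i_n0; rewrite /strand_image (negPf (low_neq_max i)) inord_val ifN.
Qed.

Lemma strand_image_low0 : strand_image (low ord0) = - \sum_i y i.
Proof. by []. Qed.

(** Variables of one strand share their image. For the last strand, the distinguished variable
    cancels against the image of the sum, which is its opposite. *)
Lemma images_theta (l : 'I_m) : (n.+1 <= l)%N -> theta N e s k sgn l \mPo images = 0.
Proof.
move=> nl; case: (lowVmax (cl (e l))) => [[i cli]|cll].
  have [c _ ->] := theta_low nl cli.
  by rewrite comp_mpolyZ comp_mpolyB !imagesE cli cl_io subrr scaler0.
rewrite theta_max // comp_mpolyD imagesE raddf_sum /= cll.
rewrite (bigD1 ord0) //= imagesE cl_io strand_image_low0 (bigD1 ord0) //=.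
rewrite [X in _ + (_ + X)](eq_bigr (fun i => y i)) => [|i i_n0].
  by rewrite {1}/strand_image /= eqxx opprD addrA addrA subrr add0r addNr.
by rewrite imagesE cl_io strand_image_low.
Qed.

(** Membership in the monomial ideal generated by the [y i ^+ bound i], read on the support. *)
Definition over_bound (f : {mpoly k[m]}) :=
  forall mm, mm \in msupp f -> exists i, (bound i <= mm (io i))%N.

Lemma over_boundM f g : over_bound g -> over_bound (f * g).
Proof.
move=> hg mm /msuppM_le/allpairsP[[m1 m2] /= [_ /hg[i bi] ->]].
by exists i; rewrite mnmDE (leq_trans bi) ?leq_addl.
Qed.

(** Dropping the minimum keeps the whole strand of the larger label, and all its variables map to
    one variable [y w]. *)
Lemma images_circ C : C \in circuits N -> over_bound (circ_monomial e k C \mPo images).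
Proof.
move=> /theta_circuitP[o [o' [oo' ->]]].
wlog lt_oo' : o o' oo' / (o < o')%N.
  move=> hw; case: (ltngtP o o') => h; first exact: hw.
    by rewrite setUC; apply: hw => //; rewrite eq_sym.
  by case/eqP: oo'; apply: val_inj.
have [i oi] : exists i, o = low i.
  case: (lowVmax o) => // om; move: lt_oo'; rewrite om /= ltnNge -ltnS.
  by rewrite ltn_ord.
subst o; rewrite circ_monomialE rmorph_prod /=.
have sub := strand_sub_cbar lt_oo'.
rewrite (big_setID [set l | e l \in strand o']) /= mulrC; apply: over_boundM.
rewrite (setIidPr sub).
have o'0 : o' != ord0 by apply: contraTneq lt_oo' => ->.
(* Index 0 stands for the last strand, so that [bound w] is the size of [o']. *)
pose w : 'I_n.+1 := if o' == ord_max then ord0 else inord o'.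
rewrite (eq_bigr (fun=> y w)) => [|l]; last first.
  by rewrite in_set => /strand_cl cl_l; rewrite imagesE cl_l /strand_image (negPf o'0).
rewrite prodr_const card_idx ?strand_subG // mpolyXn => mm.
rewrite msuppX inE => /eqP->; exists w.
rewrite mulmnE mnm1E eqxx mul1n /bound /w; case: (eqVneq o' ord_max) => [->|o'm]; first by rewrite eqxx.
case: (lowVmax o') => [[j oj]|om]; last by rewrite om eqxx in o'm.
rewrite oj inord_val ifN //; apply: contraNneq o'0 => j0; rewrite oj j0.
exact/eqP/val_inj.
Qed.

(** The substitution kills the linear forms and sends circuit monomials over a bound, so
    [bounded_free] applies to the ideal. *)
Lemma theta_L_free g : (forall mm, mm \in msupp g -> inL N e s mm) ->
  in_ideal gens g -> g = 0.
Proof.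
move=> gL Ig; apply: (bounded_free io_inj (b := bound) (h := images)).
- by move=> i i_n0; rewrite tnth_mktuple cl_io strand_image_low.
- by rewrite tnth_mktuple cl_io strand_image_low0.
- by move=> mm mg; apply/inL_bounded/gL.
rewrite -/(over_bound (g \mPo images)).
apply: (in_ideal_ind (P := fun f => over_bound (f \mPo images)) _ _ _ Ig).
- by rewrite comp_mpoly0 => mm; rewrite msupp0.
- move=> f f' hf hf'; rewrite comp_mpolyD => mm /msuppD_le.
  by rewrite mem_cat => /orP[/hf|/hf'].
move=> c f; rewrite rmorphM /= => fg; apply: over_boundM; move: fg.
rewrite mem_cat => /orP[/mapP[C]|/mapP[l]].
  by rewrite mem_enum => CN ->; exact: images_circ.
rewrite mem_filter ms => /andP[nl _] ->; rewrite images_theta // => mm.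
by rewrite msupp0.
Qed.

End ThetaOrder.

(** [s1] lists a representative of each strand but the last, by label; [s2] lists the rest of [G],
    so its size is the rank. *)
Lemma strand_ordering (T : finType) (n : nat) (G : {set T}) (cl : T -> 'I_n.+2) :
  (forall o, exists x, x \in strand G cl o) ->
  exists (m s : nat) (e : 'I_m -> T),
    [/\ m - s = n.+1, injective e, e @: setT = G &
        forall i : 'I_m, i < n.+1 -> cl (e i) = i :> nat].
Proof.
move=> ne; pose r o := xchoose (ne o).
have hr o : r o \in strand G cl o := xchooseP (ne o).
have [x0 _] := ne ord0.
pose s1 := [seq r (low i) | i <- enum 'I_n.+1].
pose s2 := [seq x <- enum G | x \notin s1].
have rinj : injective r.
  by move=> a b ab; rewrite -(strand_cl (hr a)) ab (strand_cl (hr b)).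
have usq : uniq (s1 ++ s2).
  have linj : injective (fun i => r (low i)) by move=> a b /rinj/low_inj.
  rewrite cat_uniq (map_inj_uniq linj) !enum_uniq filter_uniq ?enum_uniq //=.
  by rewrite andbT; apply/hasPn => x; rewrite mem_filter => /andP[].
have sz1 : size s1 = n.+1 by rewrite size_map size_enum_ord.
exists (size (s1 ++ s2)), (size s2), (fun i => nth x0 (s1 ++ s2) i); split.
- by rewrite size_cat addnK.
- move=> i j /eqP; rewrite nth_uniq // => /eqP; exact: val_inj.
- apply/setP => x; apply/imsetP/idP => [[i _ ->]|xG].
    have := mem_nth x0 (ltn_ord i); rewrite mem_cat => /orP[/mapP[j _ ->]|].
      exact: strandG (hr _).
    by rewrite mem_filter mem_enum => /andP[].
  have xs : x \in s1 ++ s2.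
    by rewrite mem_cat mem_filter mem_enum xG andbT orbN.
  have ix : index x (s1 ++ s2) < size (s1 ++ s2) by rewrite index_mem.
  by exists (Ordinal ix) => //=; rewrite nth_index.
move=> i lin; rewrite nth_cat sz1 lin (nth_map ord0) ?size_enum_ord //.
by rewrite (strand_cl (hr _)) /= nth_enum_ord.
Qed.

Lemma theta_has_NBC_basis (k : fieldType) (T : finType) (n : nat) (G : {set T})
    (cl : T -> 'I_n.+2) :
  (forall o, exists x, x \in strand G cl o) ->
  (forall x y, x \in strand G cl ord0 -> y \in strand G cl ord0 -> x = y) ->
  has_NBC_basis k (theta_matroid G cl).
Proof.
move=> ne un; split; first exact: theta_regular.
have [m [s [e [ms e_inj e_im e_cl]]]] := strand_ordering ne.
exists m, e, s; split=> //; first exact: (last_basisP ne ms).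
exists (circuit_sign cl), (cocircuit_sign cl); split.
  by apply: theta_admissible => //; rewrite card_ord.
split; first exact: (theta_L_spans ne un ms).
exact: (theta_L_free ne un ms).
Qed.

Lemma uniform_corank1_circuits (T : finType) (A C : {set T}) : 0 < #|A| ->
  (C \in circuits (uniform_matroid #|A|.-1 A)) = (C == A).
Proof.
move=> A0; rewrite !inE prednK //; apply/andP/eqP => [[CA /eqP h]|->//].
by apply/eqP; rewrite eqEcard CA h leqnn.
Qed.

(** * Parallel connections of circuits *)

Section ParallelConnection.
Context {T : finType} (p : T) (I : finType) (E : I -> {set T}).
Context (pE : forall i, p \in E i).

Local Notation PC r :=
  (par_conn_seq p [seq uniform_matroid #|E i|.-1 (E i) | i <- r]).

Lemma par_conn_seq_rcons (M : matroid T) Ms M' :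
  par_conn_seq p (rcons (M :: Ms) M') = par_conn (par_conn_seq p (M :: Ms)) M' p.
Proof. by rewrite /= foldl_rcons. Qed.

Lemma par_conn_seq_ground (r : seq I) : ground (PC r) = \bigcup_(i <- r) E i.
Proof.
case: r => [|i r]; first by rewrite big_nil.
elim/last_ind: r => [|r a IH]; first by rewrite big_seq1.
by rewrite -rcons_cons map_rcons par_conn_seq_rcons big_rcons /= -IH setUC.
Qed.

(** Induction on the last matroid added: among earlier circuits only the [E j] contain [p], since
    the mixed ones have lost it, so the new mixed circuits are the [(E j :|: E a) :\ p]. *)
Lemma par_conn_seq_circuits (r : seq I) C : uniq r ->
  C \in circuits (PC r) <->
  (exists2 i, i \in r & C = E i) \/
  (exists i j, [/\ i \in r, j \in r, i != j & C = (E i :|: E j) :\ p]).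
Proof.
have E0 i : 0 < #|E i| by apply/card_gt0P; exists p.
case: r => [_|i r].
  by rewrite inE; split=> // -[[]|[? [? []]]].
elim/last_ind: r C => [|r a IH] C.
  move=> _; rewrite [PC _]/= uniform_corank1_circuits //; split=> [/eqP->|].
    by left; exists i; rewrite ?inE.
  case=> [[j]|[j [l []]]]; rewrite !inE => /eqP->; first by move->.
  by move=> /eqP->; rewrite eqxx.
rewrite -rcons_cons rcons_uniq => /andP[ar ur].
have sub j : j \in i :: r -> j \in rcons (i :: r) a.
  by rewrite mem_rcons [j \in a :: _]in_cons => ->; rewrite orbT.
have ain : a \in rcons (i :: r) a by rewrite mem_rcons mem_head.
rewrite map_rcons par_conn_seq_rcons -/(PC (i :: r)).
rewrite [circuits _]/= 2!in_setU uniform_corank1_circuits //; split.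
  case/orP=> [/orP[/(IH _ ur)|/eqP->]|].
  - case=> [[j jr ->]|[j [l [jr lr jl ->]]]]; [left; exists j|right; exists j, l] => //.
      exact: sub.
    by split=> //; exact: sub.
  - by left; exists a.
  case/imset2P=> C1 C2 C1c; rewrite inE uniform_corank1_circuits //.
  case/and3P=> /eqP-> pC1 _ ->; case/(IH _ ur): C1c => [[j jr e1]|[j [l [_ _ _ e1]]]].
    right; exists j, a; rewrite e1; split=> //; first exact: sub.
    by apply: contraNneq ar => <-.
  by rewrite e1 !inE eqxx in pC1.
have conn j : j \in i :: r -> (E j :|: E a) :\ p \in
    [set (C1 :|: C2) :\ p | C1 in circuits (PC (i :: r)),
       C2 in circuits (uniform_matroid #|E a|.-1 (E a)) & (p \in C1) && (p \in C2)].
  move=> jr; apply/imset2P; exists (E j) (E a) => //.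
    by apply/(IH _ ur); left; exists j.
  by rewrite inE uniform_corank1_circuits // eqxx !pE.
case=> [[j]|[j [l []]]].
  rewrite mem_rcons [j \in a :: _]in_cons => /orP[/eqP-> ->|jr ->]; first by rewrite eqxx orbT.
  by apply/orP; left; apply/orP; left; apply/(IH _ ur); left; exists j.
rewrite !mem_rcons [j \in a :: _]in_cons [l \in a :: _]in_cons.
move=> /orP[/eqP->|jr] /orP[/eqP->|lr] jl ->.
- by rewrite eqxx in jl.
- by rewrite setUC conn ?orbT.
- by rewrite conn ?orbT.
by apply/orP; left; apply/orP; left; apply/(IH _ ur); right; exists j, l.
Qed.
End ParallelConnection.

(** * Parallel connections of circuits as theta matroids *)

Section ParallelConnectionTheta.
Context {T : finType} (p : T) (n : nat) (E : 'I_n.+1 -> {set T}).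
Context (pE : forall i, p \in E i) (E_gt1 : forall i, 1 < #|E i|).
Context (E_cap : forall i j, i != j -> E i :&: E j = [set p]).

(** Label 0 is meant for [p]; points outside [G] also receive it, but strands are cut with [G]. *)
Definition petal (x : T) : 'I_n.+2 :=
  if [pick i | x \in E i :\ p] is Some i then lift ord0 i else ord0.

Local Notation G := (\bigcup_i E i).

Lemma petalE i x : x \in E i :\ p -> petal x = lift ord0 i.
Proof.
move=> xi; rewrite /petal; case: pickP => [j xj|/(_ i)]; last by rewrite xi.
congr (lift ord0); apply/eqP/negPn/negP => /E_cap/setP/(_ x).
by move: xi xj; rewrite !inE => /andP[/negPf-> ->] /andP[_ ->].
Qed.

Lemma strand_petal0 : strand G petal ord0 = [set p].
Proof.
apply/setP => x; rewrite in_strand in_set1; apply/andP/eqP => [[/bigcupP[i _ xi]]|->].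
  apply: contraTeq => xp; rewrite (@petalE i) ?inE ?xp //.
split; first by apply/bigcupP; exists ord0.
by rewrite /petal; case: pickP => // i; rewrite !inE eqxx.
Qed.

Lemma strand_petalS i : strand G petal (lift ord0 i) = E i :\ p.
Proof.
apply/setP => x; rewrite in_strand; apply/andP/idP => [[_ /eqP]|xi].
  by rewrite /petal; case: pickP => // j xj /lift_inj <-.
split; last by rewrite (petalE xi).
by apply/bigcupP; exists i => //; move: xi; rewrite inE => /andP[].
Qed.

(** Each [E i] joins the strand of [p] to a petal, and [(E i :|: E j) :\ p] joins two petals. *)
Lemma par_conn_seq_theta :
  par_conn_seq p [seq uniform_matroid #|E i|.-1 (E i) | i <- enum 'I_n.+1] =
  theta_matroid G petal.
Proof.
set M := par_conn_seq _ _.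
suff [hg hc] : ground M = G /\ circuits M = circuits (theta_matroid G petal).
  by case: M hg hc => g c /= -> ->.
have pU i : [set p] :|: E i :\ p = E i by rewrite setD1K.
split; first by rewrite par_conn_seq_ground big_enum.
apply/setP => C; apply/idP/theta_circuitP => [|[o [o' [oo' ->]]]].
  case/(par_conn_seq_circuits pE _ (enum_uniq _)) => [[i _ ->]|[i [j [_ _ ij ->]]]].
    by exists ord0, (lift ord0 i); rewrite strand_petal0 strand_petalS pU.
  exists (lift ord0 i), (lift ord0 j); rewrite !strand_petalS setDUl; split=> //.
apply/(par_conn_seq_circuits pE _ (enum_uniq _)).
case: (unliftP ord0 o) oo' => [i|] ->; case: (unliftP ord0 o') => [j|] -> // oo'.
- right; exists i, j; rewrite !mem_enum !strand_petalS setDUl; split=> //.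
- by left; exists i; rewrite ?mem_enum // setUC strand_petalS strand_petal0 pU.
by left; exists j; rewrite ?mem_enum // strand_petalS strand_petal0 pU.
Qed.

Lemma par_conn_has_NBC_basis (k : fieldType) : has_NBC_basis k
  (par_conn_seq p [seq uniform_matroid #|E i|.-1 (E i) | i <- enum 'I_n.+1]).
Proof.
rewrite par_conn_seq_theta; apply: theta_has_NBC_basis.
  move=> o; case: (unliftP ord0 o) => [i|] ->; last first.
    by exists p; rewrite strand_petal0 set11.
  rewrite strand_petalS; apply/set0Pn; rewrite -card_gt0 -ltnS.
  by have := E_gt1 i; rewrite (cardsD1 p) pE.
by move=> x y; rewrite strand_petal0 !inE => /eqP-> /eqP->.
Qed.
End ParallelConnectionTheta.

Theorem theorem5p6 (k : fieldType) (T : finType) (p : T) (t : nat)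
    (E : 'I_t -> {set T}) :
  (0 < t)%N ->
  (forall i, 2 <= #|E i|)%N ->
  (forall i j, i != j -> E i :&: E j = [set p]) ->
  has_NBC_basis k
    (par_conn_seq p [seq uniform_matroid (#|E i|).-1 (E i) | i <- enum 'I_t]).
Proof.
case: t E => // -[|n] E _ E2 Ecap; last first.
  apply: par_conn_has_NBC_basis => // i.
  (* With at least two sets, [p] lies in [E i] because it lies in the intersection with another
     one. *)
  have [j ij] : exists j, i != j.
    by exists (lift i ord0); exact: neq_lift.
  by have := Ecap _ _ ij => /setP/(_ p); rewrite !inE eqxx => /andP[].
(* A single matroid need not contain p, but then the base point is irrelevant. *)
have /card_gt0P[q qE] : (0 < #|E ord0|)%N by apply: ltnW.
have := @par_conn_has_NBC_basis T q 0 E _ E2 _ k.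
rewrite enum_ordSl /= (_ : enum 'I_0 = [::]) //=; last first.
  by apply: size0nil; rewrite size_enum_ord.
apply; first by move=> i; rewrite (ord1 i).
by move=> i j; rewrite (ord1 i) (ord1 j) eqxx.
Qed.
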